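(* Let $L$ be a compatible sublattice of $L_n$. Then $\mathcal{R}_{\mathbb{K}}[L]$ is an algebra with straightening laws (ASL) on $L$ over $\mathbb{K}$. In particular, the ideal $I_L$ is quadratically generated and $\mathcal{R}_{\mathbb{K}}[L]$ is Cohen--Macaulay. Furthermore, $I_L$ is an elimination ideal of the Plücker ideal $I_{L_n}$, namely $I_L = I_{L_n}\cap \mathbb{K}[\,p_{ij} : p_{ij}\in L\,]$.
   Context: Let $n\ge 2$, let $\mathbb{K}$ be a field and $A=\mathbb{K}[x_1,\dots,x_n,y_1,\dots,y_n]$. Let $L_n=\{p_{ij}:1\le i<j\le n\}$ with partial order $p_{ij}\le p_{k\ell}$ iff $i\le k$ and $j\le \ell$; this is a distributive lattice with meet $p_{\min(i,k),\min(j,\ell)}$ and join $p_{\max(i,k),\max(j,\ell)}$. A sublattice of $L_n$ is a nonempty subset closed under meet and join. Let $\Pi_n$ be the same set $\{p_{ij}:1\le i<j\le n\}$ with the partial order $p_{ij}\le p_{k\ell}$ iff $i\le k$ and $j\ge \ell$. A poset ideal of a poset $P$ is a subset $J$ such that $\alpha\in J$, $\beta\in P$, $\beta<\alpha$ imply $\beta\in J$. A sublattice $L\subseteq L_n$ is compatible (with $\Pi_n$) if every index in $[n]=\{1,\dots,n\}$ occurs as $i$ or $j$ in some $p_{ij}\in L$, and $L_n\setminus L$ is a poset ideal of $\Pi_n$. The $p_{ij}$ also denote variables of the polynomial ring $S=\mathbb{K}[p_{ij}:1\le i<j\le n]$. For a sublattice $L$ of $L_n$, $\mathcal{R}_{\mathbb{K}}[L]$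 is the $\mathbb{K}$-subalgebra of $A$ generated by the binomials $x_iy_j-x_jy_i$ with $p_{ij}\in L$, and $I_L$ is the kernel of the $\mathbb{K}$-algebra map $\mathbb{K}[p_{ij}:p_{ij}\in L]\to A$, $p_{ij}\mapsto x_iy_j-x_jy_i$. For $L=L_n$ the ideal $I_{L_n}\subset S$ is the Plücker ideal. Quadratically generated means generated by homogeneous polynomials of degree 2. ASL: Let $R=\bigoplus_{m\ge0}R_m$ be a noetherian graded $\mathbb{K}$-algebra, $P$ a finite poset and $\varphi:P\hookrightarrow\bigcup_{m\ge1}R_m$ an injection such that $\varphi(P)$ generates $R$ as a $\mathbb{K}$-algebra. A standard monomial is a product $\varphi(\gamma_1)\cdots\varphi(\gamma_r)$ with $\gamma_1\le\cdots\le\gamma_r$ in $P$ (the empty product is $1$). $R$ is an ASL on $P$ over $\mathbb{K}$ if (ASL-1) the standard monomials form a $\mathbb{K}$-basis of $R$; (ASL-2) if $\alpha,\beta\in P$ are incomparable and $\varphi(\alpha)\varphi(\beta)=\sum_i r_i\varphi(\gamma_{i_1})\varphi(\gamma_{i_2})\cdots$ with $0\ne r_i\in\mathbb{K}$, $\gamma_{i_1}\le\gamma_{i_2}\le\cdots$, is the unique expression as a linear combination of distinct standard monomials, then $\gamma_{i_1}\le\alpha$ and $\gamma_{i_1}\le\beta$ for every $i$ (the sum may be empty). For $\mathcal{R}_{\mathbb{K}}[L]$ the map $\varphi$ is $p_{ij}\mapsto x_iy_j-x_jy_i$, and the grading is the one inherited from $A$. *)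

(* Defs.v *)
From HB Require Import structures.
From mathcomp Require Import all_boot all_order all_algebra.
From mathcomp Require Import generic_quotient ring_quotient.
From mathcomp Require Import boolp mpoly ring.

Set Implicit Arguments.
Unset Strict Implicit.
Unset Printing Implicit Defensive.

Import Order.TTheory GRing.Theory.

Local Open Scope ring_scope.

(* Ideals.  In the library, [idealr_closed] and [prime_idealr] only concern
   proper ideals. *)

Definition ideal_gen (R : comNzRingType) (G : R -> Prop) (a : R) : Prop :=
  exists s : seq (R * R),
    (forall cg, cg \in s -> G cg.2) /\ a = \sum_(cg <- s) cg.1 * cg.2.

Definition noetherian_ring (R : comNzRingType) : Prop :=
  forall I : {pred R}, idealr_closed I ->
  exists s : seq R, forall a, a \in I <-> ideal_gen (fun g => g \in s) a.

Definition maximal_ideal (R : comNzRingType) (m : {pred R}) : Prop :=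
  idealr_closed m /\
  forall J : {pred R}, idealr_closed J -> {subset m <= J} -> {subset J <= m}.

Definition prime_ideal (R : comNzRingType) (p : {pred R}) : Prop :=
  idealr_closed p /\ prime_idealr_closed p.

Section Localization.

Variables (R : comNzRingType) (p : prime_idealr R).

Record loc_ratio := LocRatio {
  loc_frac : R * R;
  loc_fracP : loc_frac.2 \notin (p : {pred R}) }.

HB.instance Definition _ := [isSub for loc_frac].
HB.instance Definition _ := [Choice of loc_ratio by <:].

Local Notation "'\n_' x" := (loc_frac x).1.
Local Notation "'\d_' x" := (loc_frac x).2.

Let denom (d : R) := d \notin (p : {pred R}).

Lemma loc_denom1 : denom 1.
Proof. by rewrite /denom idealr1. Qed.

Lemma loc_denomM (d e : R) : denom d -> denom e -> denom (d * e).
Proof. by rewrite /denom prime_idealrM negb_or => -> ->. Qed.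

Definition loc_equiv (x y : loc_ratio) : bool :=
  `[< exists2 u : R, u \notin (p : {pred R}) &
        u * (\n_x * \d_y - \n_y * \d_x) = 0 >].

Lemma loc_equivP (x y : loc_ratio) :
  reflect (exists2 u : R, denom u & u * (\n_x * \d_y - \n_y * \d_x) = 0)
          (loc_equiv x y).
Proof. exact: asboolP. Qed.

Lemma loc_equiv_refl : reflexive loc_equiv.
Proof.
by move=> x; apply/loc_equivP; exists 1; rewrite ?loc_denom1 // subrr mulr0.
Qed.

Lemma loc_equiv_sym : ssrbool.symmetric loc_equiv.
Proof.
have imp x y : loc_equiv x y -> loc_equiv y x.
  move=> /loc_equivP[u du e]; apply/loc_equivP; exists u => //.
  by rewrite -opprB mulrN e oppr0.
by move=> x y; apply/idP/idP; apply: imp.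
Qed.

Lemma loc_equiv_trans : transitive loc_equiv.
Proof.
move=> y x z /loc_equivP[u du xy] /loc_equivP[v dv yz]; apply/loc_equivP.
exists (u * v * \d_y); first by do 2?[apply: loc_denomM] => //;
  exact: loc_fracP.
rewrite (_ : _ * _ =
  v * \d_z * (u * (\n_x * \d_y - \n_y * \d_x)) +
  u * \d_x * (v * (\n_y * \d_z - \n_z * \d_y))); last by ring.
by rewrite xy yz !mulr0 addr0.
Qed.

Canonical loc_equiv_equiv :=
  EquivRel loc_equiv loc_equiv_refl loc_equiv_sym loc_equiv_trans.

Definition localization : Type := {eq_quot loc_equiv}%qT.

HB.instance Definition _ : EqQuotient _ loc_equiv localization :=
  EqQuotient.on localization.
HB.instance Definition _ := Choice.on localization.

Local Open Scope quotient_scope.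
Local Notation to_loc := (\pi_(localization)).

Lemma loc_piP (x y : loc_ratio) :
  reflect (exists2 u : R, denom u & u * (\n_x * \d_y - \n_y * \d_x) = 0)
          (to_loc x == to_loc y).
Proof. by rewrite eqmodE; exact: loc_equivP. Qed.

Lemma loc_pi_eq (x y : loc_ratio) :
  \n_x * \d_y = \n_y * \d_x -> to_loc x = to_loc y.
Proof.
move=> e; apply/eqP/loc_piP; exists 1; first exact: loc_denom1.
by rewrite e subrr mulr0.
Qed.

Lemma loc_reprP (x : loc_ratio) : exists2 u : R, denom u &
  u * (\n_(repr (to_loc x)) * \d_x - \n_x * \d_(repr (to_loc x))) = 0.
Proof. by apply/loc_piP; rewrite reprK. Qed.

Definition loc_addf (x y : loc_ratio) : loc_ratio :=
  @LocRatio (\n_x * \d_y + \n_y * \d_x, \d_x * \d_y)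
            (loc_denomM (loc_fracP x) (loc_fracP y)).
Definition loc_oppf (x : loc_ratio) : loc_ratio :=
  @LocRatio (- \n_x, \d_x) (loc_fracP x).
Definition loc_mulf (x y : loc_ratio) : loc_ratio :=
  @LocRatio (\n_x * \n_y, \d_x * \d_y)
            (loc_denomM (loc_fracP x) (loc_fracP y)).
Definition loc_cst (a : R) : loc_ratio := @LocRatio (a, 1) loc_denom1.

Definition loc_add := lift_op2 localization loc_addf.
Definition loc_opp := lift_op1 localization loc_oppf.
Definition loc_mul := lift_op2 localization loc_mulf.
Definition loc_of (a : R) : localization := to_loc (loc_cst a).

Lemma loc_pi_add x y : loc_add (to_loc x) (to_loc y) = to_loc (loc_addf x y).
Proof.
have [u du ex] := loc_reprP x; have [v dv ey] := loc_reprP y.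
unlock loc_add; apply/eqP/loc_piP; exists (u * v); first exact: loc_denomM.
move: ex ey; set x' := repr _; set y' := repr _ => ex ey /=.
rewrite (_ : _ * _ =
  v * \d_y * \d_y' * (u * (\n_x' * \d_x - \n_x * \d_x')) +
  u * \d_x * \d_x' * (v * (\n_y' * \d_y - \n_y * \d_y'))); last by ring.
by rewrite ex ey !mulr0 addr0.
Qed.

Lemma loc_pi_opp x : loc_opp (to_loc x) = to_loc (loc_oppf x).
Proof.
have [u du ex] := loc_reprP x; unlock loc_opp.
apply/eqP/loc_piP; exists u => //.
move: ex; set x' := repr _ => ex /=.
rewrite (_ : _ * _ = - (u * (\n_x' * \d_x - \n_x * \d_x'))); last by ring.
by rewrite ex oppr0.
Qed.

Lemma loc_pi_mul x y : loc_mul (to_loc x) (to_loc y) = to_loc (loc_mulf x y).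
Proof.
have [u du ex] := loc_reprP x; have [v dv ey] := loc_reprP y.
unlock loc_mul; apply/eqP/loc_piP; exists (u * v); first exact: loc_denomM.
move: ex ey; set x' := repr _; set y' := repr _ => ex ey /=.
rewrite (_ : _ * _ =
  v * \n_y' * \d_y * (u * (\n_x' * \d_x - \n_x * \d_x')) +
  u * \n_x * \d_x' * (v * (\n_y' * \d_y - \n_y * \d_y'))); last by ring.
by rewrite ex ey !mulr0 addr0.
Qed.

Fact loc_addA : associative loc_add.
Proof.
elim/quotW=> x; elim/quotW=> y; elim/quotW=> z; rewrite !loc_pi_add.
by apply: loc_pi_eq => /=; ring.
Qed.

Fact loc_addC : commutative loc_add.
Proof.
elim/quotW=> x; elim/quotW=> y; rewrite !loc_pi_add.
by apply: loc_pi_eq => /=; ring.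
Qed.

Fact loc_add0 : left_id (loc_of 0) loc_add.
Proof.
by elim/quotW=> x; rewrite loc_pi_add; apply: loc_pi_eq => /=; ring.
Qed.

Fact loc_addN : left_inverse (loc_of 0) loc_opp loc_add.
Proof.
elim/quotW=> x; rewrite loc_pi_opp loc_pi_add.
by apply: loc_pi_eq => /=; ring.
Qed.

HB.instance Definition _ := GRing.isZmodule.Build localization
  loc_addA loc_addC loc_add0 loc_addN.

Fact loc_mulA : associative loc_mul.
Proof.
elim/quotW=> x; elim/quotW=> y; elim/quotW=> z; rewrite !loc_pi_mul.
by apply: loc_pi_eq => /=; ring.
Qed.

Fact loc_mulC : commutative loc_mul.
Proof.
elim/quotW=> x; elim/quotW=> y; rewrite !loc_pi_mul.
by apply: loc_pi_eq => /=; ring.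
Qed.

Fact loc_mul1 : left_id (loc_of 1) loc_mul.
Proof.
by elim/quotW=> x; rewrite loc_pi_mul; apply: loc_pi_eq => /=; ring.
Qed.

Fact loc_mulDl : left_distributive loc_mul loc_add.
Proof.
elim/quotW=> x; elim/quotW=> y; elim/quotW=> z.
rewrite !loc_pi_add !loc_pi_mul !loc_pi_add.
by apply: loc_pi_eq => /=; ring.
Qed.

Fact loc_1neq0 : loc_of 1 != loc_of 0.
Proof.
apply/negP => /loc_piP[u du /=]; rewrite !mulr1 subr0 mulr1 => u0.
by move: du; rewrite /denom u0 idealr0.
Qed.

HB.instance Definition _ := GRing.Zmodule_isComNzRing.Build localization
  loc_mulA loc_mulC loc_mul1 loc_mulDl loc_1neq0.

End Localization.

Definition prime_chain (R : comNzRingType) (d : nat) : Prop :=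
  exists p : nat -> {pred R},
    (forall i, (i <= d)%N -> prime_ideal (p i)) /\
    (forall i, (i < d)%N ->
       {subset p i <= p i.+1} /\ ~ {subset p i.+1 <= p i}).

Definition has_krull_dim (R : comNzRingType) (d : nat) : Prop :=
  prime_chain R d /\ forall e, prime_chain R e -> (e <= d)%N.

Definition regular_sequence (R : comNzRingType) (s : seq R) : Prop :=
  (forall i, (i < size s)%N -> forall a : R,
     ideal_gen (fun g => g \in take i s) (s`_i * a) ->
     ideal_gen (fun g => g \in take i s) a) /\
  ~ ideal_gen (fun g => g \in s) 1.

Definition has_regular_sequence (R : comNzRingType) (I : {pred R}) (d : nat) :
    Prop :=
  exists s : seq R,
    [/\ size s = d, {subset s <= I} & regular_sequence s].

Definition has_depth (R : comNzRingType) (m : {pred R}) (d : nat) : Prop :=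
  has_regular_sequence m d /\
  forall e, has_regular_sequence m e -> (e <= d)%N.

Definition cohen_macaulay_local (R : comNzRingType) : Prop :=
  noetherian_ring R /\
  exists m : {pred R},
    [/\ maximal_ideal m,
        forall m' : {pred R}, maximal_ideal m' -> m' =i m &
        exists d, has_krull_dim R d /\ has_depth m d].

Definition cohen_macaulay (R : comNzRingType) : Prop :=
  noetherian_ring R /\
  forall m : prime_idealr R, maximal_ideal (m : {pred R}) ->
    cohen_macaulay_local (localization m).

Section GeneratedSubalgebra.

Variables (K : fieldType) (A : comAlgType K) (G : A -> Prop).

Definition gen_subalg : {pred A} := [pred a | `[<
  forall S : {pred A}, GRing.subalg_closed S ->
    (forall g, G g -> g \in S) -> a \in S >]].

Lemma gen_subalg_closed : GRing.subalg_closed gen_subalg.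
Proof.
split.
- by apply/asboolP => S [S1 _ _] _.
- move=> c a b /asboolP ha /asboolP hb; apply/asboolP => S hS GS.
  by have [_ SL _] := hS; apply: SL; [apply: ha | apply: hb].
- move=> a b /asboolP ha /asboolP hb; apply/asboolP => S hS GS.
  by have [_ _ SM] := hS; apply: SM; [apply: ha | apply: hb].
Qed.

Lemma mem_gen_subalg (g : A) : G g -> g \in gen_subalg.
Proof. by move=> Gg; apply/asboolP => S _; apply. Qed.

HB.instance Definition _ :=
  GRing.isSubalgClosed.Build K A gen_subalg gen_subalg_closed.

Record subalg := Subalg {
  subalg_val :> A;
  subalg_valP : subalg_val \in gen_subalg }.

HB.instance Definition _ := [isSub for subalg_val].
HB.instance Definition _ := [Choice of subalg by <:].
HB.instance Definition _ := [SubChoice_isSubComNzRing of subalg by <:].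
HB.instance Definition _ := [SubZmodule_isSubLmodule of subalg by <:].
HB.instance Definition _ :=
  [SubNzRing_SubLmodule_isSubLalgebra of subalg by <:].
HB.instance Definition _ := [SubLalgebra_isSubAlgebra of subalg by <:].

End GeneratedSubalgebra.

(* Algebras with straightening laws.  A standard monomial is indexed by the
   multichain of its factors, i.e. by a sorted sequence of poset elements. *)

Definition graded_by (K : fieldType) (R : comAlgType K)
    (Rm : nat -> {pred R}) : Prop :=
  [/\ forall m, GRing.submod_closed (Rm m),
      forall i j a b, a \in Rm i -> b \in Rm j -> a * b \in Rm (i + j)%N,
      forall a : R, exists (N : nat) (c : nat -> R),
        (forall m, c m \in Rm m) /\ a = \sum_(m < N) c m &
      forall (N : nat) (c : nat -> R), (forall m, c m \in Rm m) ->
        \sum_(m < N) c m = 0 -> forall m, (m < N)%N -> c m = 0].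

Section ASL.

Variables (K : fieldType) (R : comAlgType K).
Variables (disp : Order.disp_t) (P : finPOrderType disp) (phi : P -> R).

Definition multichain (s : seq P) : bool := sorted (<=%O : rel P) s.

Definition std_monomial (s : seq P) : R := \prod_(g <- s) phi g.

Definition std_comb (ms : seq (seq P)) (c : seq P -> K) : R :=
  \sum_(s <- ms) c s *: std_monomial s.

Definition asl1 : Prop :=
  (forall a : R, exists (ms : seq (seq P)) (c : seq P -> K),
     all multichain ms /\ a = std_comb ms c) /\
  (forall (ms : seq (seq P)) (c : seq P -> K),
     uniq ms -> all multichain ms -> std_comb ms c = 0 ->
     forall s, s \in ms -> c s = 0).

Definition asl2 : Prop :=
  forall a b : P, ~~ (a >=< b)%O ->
  forall (ms : seq (seq P)) (c : seq P -> K),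
    uniq ms -> all multichain ms -> (forall s, s \in ms -> c s != 0) ->
    phi a * phi b = std_comb ms c ->
  forall s, s \in ms ->
  exists (g : P) (s' : seq P), [/\ s = g :: s', (g <= a)%O & (g <= b)%O].

Record is_ASL (Rm : nat -> {pred R}) : Prop := IsASL {
  asl_noetherian : noetherian_ring R;
  asl_graded : graded_by Rm;
  asl_inj : injective phi;
  asl_homog : forall p, exists2 m, (1 <= m)%N & phi p \in Rm m;
  asl_generated : forall a : R, a \in gen_subalg (fun g => exists p, g = phi p);
  asl_basis : asl1;
  asl_straightening : asl2 }.

End ASL.

(* The lattice L_n and the poset Pi_n, with indices 0, ..., n - 1 in place of
   1, ..., n. *)

Definition increasing_pair (n : nat) (ij : 'I_n *p 'I_n) : bool :=
  (ij.1 < ij.2)%N.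

Record Lat (n : nat) := LatPair {
  Lat_pair : 'I_n *p 'I_n;
  Lat_pairP : increasing_pair Lat_pair }.

Definition fst_index n (p : Lat n) : 'I_n := (Lat_pair p).1.
Definition snd_index n (p : Lat n) : 'I_n := (Lat_pair p).2.

HB.instance Definition _ n := [isSub for @Lat_pair n].
HB.instance Definition _ n := [Finite of Lat n by <:].

Fact Lat_display : Order.disp_t. Proof. exact: (Order.Disp tt tt). Qed.

Lemma ord_meetE n (i j : 'I_n) : Order.meet i j = minn i j :> nat.
Proof. by rewrite meetEtotal minElt ltEord; case: ltnP. Qed.

Lemma ord_joinE n (i j : 'I_n) : Order.join i j = maxn i j :> nat.
Proof. by rewrite joinEtotal maxElt ltEord; case: ltnP. Qed.

Fact increasing_pair_meet n :
  {in @increasing_pair n &, forall p q, Order.meet p q \in @increasing_pair n}.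
Proof.
move=> [i j] [k l]; rewrite !unfold_in /increasing_pair meetEprod /=.
rewrite !meetEtotal !minEnat => ij kl.
by rewrite leq_min !gtn_min ij kl orbT.
Qed.

Fact increasing_pair_join n :
  {in @increasing_pair n &, forall p q, Order.join p q \in @increasing_pair n}.
Proof.
move=> [i j] [k l]; rewrite !unfold_in /increasing_pair joinEprod /=.
rewrite !joinEtotal !maxEnat => ij kl.
by rewrite gtn_max !leq_max ij kl orbT.
Qed.

HB.instance Definition _ n :=
  Order.SubChoice_isSubLattice.Build _ _ (@increasing_pair n) Lat_display
    (Lat n)
    (@increasing_pair_meet n) (@increasing_pair_join n).

Lemma Lat_leE n (p q : Lat n) :
  (p <= q)%O = (fst_index p <= fst_index q)%N && (snd_index p <= snd_index q)%N.
Proof. by []. Qed.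

Lemma Lat_meetE n (p q : Lat n) :
  (fst_index (Order.meet p q) = minn (fst_index p) (fst_index q) :> nat) *
  (snd_index (Order.meet p q) = minn (snd_index p) (snd_index q) :> nat).
Proof. by rewrite -!ord_meetE. Qed.

Lemma Lat_joinE n (p q : Lat n) :
  (fst_index (Order.join p q) = maxn (fst_index p) (fst_index q) :> nat) *
  (snd_index (Order.join p q) = maxn (snd_index p) (snd_index q) :> nat).
Proof. by rewrite -!ord_joinE. Qed.

Definition Pi (n : nat) : Type := Lat n.

HB.instance Definition _ n := Finite.copy (Pi n) (Lat n).

Definition Pi_le n (p q : Pi n) : bool :=
  (fst_index p <= fst_index q)%N && (snd_index q <= snd_index p)%N.

Fact Pi_le_refl n : reflexive (@Pi_le n).
Proof. by move=> p; rewrite /Pi_le !leqnn. Qed.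

Fact Pi_le_anti n : ssrbool.antisymmetric (@Pi_le n).
Proof.
move=> [[i j] p] [[k l] q]; rewrite /Pi_le /=.
move=> /andP[/andP[ik lj] /andP[ki jl]].
apply: val_inj => /=; congr (_, _); apply/val_inj/anti_leq.
  by rewrite ik ki.
by rewrite jl lj.
Qed.

Fact Pi_le_trans n : ssrbool.transitive (@Pi_le n).
Proof.
move=> q p r /andP[pq1 pq2] /andP[qr1 qr2]; rewrite /Pi_le.
by rewrite (leq_trans pq1 qr1) (leq_trans qr2 pq2).
Qed.

Fact Pi_display : Order.disp_t. Proof. exact: (Order.Disp tt tt). Qed.

HB.instance Definition _ n := Order.Le_isPOrder.Build Pi_display (Pi n)
  (@Pi_le_refl n) (@Pi_le_anti n) (@Pi_le_trans n).

Definition poset_ideal disp (P : finPOrderType disp) (J : {set P}) : Prop :=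
  forall a b : P, a \in J -> (b < a)%O -> b \in J.

Definition sublattice disp (T : finLatticeType disp) (L : {set T}) : Prop :=
  L != set0 /\
  {in L &, forall a b, Order.meet a b \in L /\ Order.join a b \in L}.

Definition compatible (n : nat) (L : {set Lat n}) : Prop :=
  (forall k : 'I_n,
     exists2 p : Lat n, p \in L & k = fst_index p \/ k = snd_index p) /\
  poset_ideal (~: L : {set Pi n}).

Section SubPoset.

Variables (disp : Order.disp_t) (P : finPOrderType disp) (L : {set P}).

Definition subposet : Type := {p : P | p \in L}.

HB.instance Definition _ := SubFinite.copy subposet {p : P | p \in L}.
HB.instance Definition _ := [SubChoice_isSubPOrder of subposet by <: with disp].

End SubPoset.

(* RL is the algebra R_K[L], and IL the ideal I_L. *)

Section PluckerAlgebra.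

Variables (K : fieldType) (n : nat).

(* K[x_1, ..., x_n, y_1, ..., y_n]: the x_i come first. *)
Definition xvar (i : 'I_n) : {mpoly K[n + n]} := 'X_(lshift n i).
Definition yvar (i : 'I_n) : {mpoly K[n + n]} := 'X_(rshift n i).

Definition binomial_minor (p : Lat n) : {mpoly K[n + n]} :=
  xvar (fst_index p) * yvar (snd_index p) -
  xvar (snd_index p) * yvar (fst_index p).

Variable L : {set Lat n}.

Definition is_generator (f : {mpoly K[n + n]}) : Prop :=
  exists2 p : Lat n, p \in L & f = binomial_minor p.

Definition RL : Type := subalg is_generator.

HB.instance Definition _ := GRing.SubComNzRing.on RL.
HB.instance Definition _ := GRing.ComAlgebra.on RL.

Definition RL_graded (m : nat) : {pred RL} :=
  [pred f : RL | (subalg_val f) \is m.-homog].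

Lemma RL_phi_subproof (p : subposet L) :
  binomial_minor (val p) \in gen_subalg is_generator.
Proof. by apply: mem_gen_subalg; exists (val p) => //; apply: valP. Qed.

Definition RL_phi (p : subposet L) : RL := Subalg (RL_phi_subproof p).

(* The variables of K[p_ij : p_ij in L] are indexed by positions in L: 'X_i
   stands for p_ij = enum_val i. *)
Definition plucker_map (f : {mpoly K[#|L|]}) : {mpoly K[n + n]} :=
  f \mPo [tuple binomial_minor (enum_val i) | i < #|L|].

Definition IL : {pred {mpoly K[#|L|]}} := [pred f | plucker_map f == 0].

(* The Plucker ideal is IL [set: Lat n], in S = {mpoly K[#|[set: Lat n]|]}. *)

Definition lat_incl (f : {mpoly K[#|L|]}) : {mpoly K[#|[set: Lat n]|]} :=
  f \mPo [tuple 'X_(enum_rank_in (in_setT (enum_val i)) (enum_val i))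
          | i < #|L|].

Definition lat_subring : {pred {mpoly K[#|[set: Lat n]|]}} :=
  gen_subalg (fun g : {mpoly K[#|[set: Lat n]|]} =>
    exists2 i, enum_val i \in L & g = 'X_i).

End PluckerAlgebra.

Arguments binomial_minor K {n} p.
Arguments RL K {n} L.
Arguments RL_graded K {n} L m.
Arguments RL_phi K {n} L p.
Arguments plucker_map {K n} L f.
Arguments IL K {n} L.
Arguments lat_incl {K n} L f.
Arguments lat_subring K {n} L.

Definition quadratically_generated (K : fieldType) (k : nat)
    (I : {pred {mpoly K[k]}}) : Prop :=
  exists G : {pred {mpoly K[k]}},
    (forall g, g \in G -> g \is 2.-homog) /\
    forall f, f \in I <-> ideal_gen (fun g => g \in G) f.

(* Main.v *)
Require Import Defs.
From HB Require Import structures.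
From mathcomp Require Import all_boot all_order all_algebra.
From mathcomp Require Import generic_quotient ring_quotient.
From mathcomp Require Import boolp mpoly ring zify.
From mathcomp Require classical_sets.

(** Read [p_ij] as the interval from [i] to [j]. Compatibility says that [L] is closed
    under subintervals ([subposet_interval]). Two elements are incomparable exactly when
    one interval lies strictly inside the other, and then the three-term relation

      [p_ad p_bc = p_ac p_bd - p_ab p_cd]      for [a < b < c < d]

    expresses their product through other elements of [L]. Each use of it pushes levels
    [i + j] apart, which increases the sum of their squares; hence the standard monomials
    span ([straighten_le]). The leading monomial of a standard monomial is the product of
    the [x_i] and the [y_j] over its factors, and it determines the multichain, so the
    standard monomials are independent ([std_free]). This gives the straightening laws;
    carried out in the polynomial ring modulo quadrics, it also gives generation of [IL]
    by quadrics. The statement on elimination holds because the map defining [IL] is the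
    restriction of the map defining the Pluecker ideal.

    For Cohen-Macaulayness let [theta_j] be the sum of the elements of level [j], for the
    [d] levels that occur in [L]. A multichain is a lattice path in the plane, and it is
    determined by its levels and its corners ([corners_width]). Multiplying the product of
    its corners by the [theta]'s of the remaining levels gives the multichain itself plus
    later standard monomials ([hodge_expand]). So these products form a basis, and
    multiplication by a [theta_j] maps the basis into itself ([level_insert]): the algebra
    is a finite free module over the polynomial ring in the [theta]'s. It follows that
    nonzero polynomials [f_j(theta_j)], one for each level, are regular in any order, as
    long as they generate a proper ideal ([remainder_operator], [regular_of_remainders]).
    By the Nullstellensatz every maximal ideal contains such a sequence of length [d].

    In the other direction, a chain of primes of length [e] yields [e] algebraically
    independent elements ([prime_chain_independent]), and there are only about [M ^ d]
    multichains of length [M], so [e <= d] ([prime_chain_bound]). Finally a regular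
    sequence contained in a prime gives a chain of primes of the same length
    ([regular_prime_chain]), so both the dimension and the depth of each localization at
    a maximal ideal are [d] ([cohen_macaulay_at]). *)

Set Implicit Arguments.
Unset Strict Implicit.
Unset Printing Implicit Defensive.

Import Order.TTheory GRing.Theory.

Local Open Scope ring_scope.

(** * Linear combinations over an indexed family *)

Section Spans.

Variables (K : fieldType) (V : lmodType K) (I : choiceType).

Definition spans (B : I -> V) (Q : pred I) (x : V) : Prop :=
  exists2 l : seq (K * I), all (fun ci => Q ci.2) l &
    x = \sum_(ci <- l) ci.1 *: B ci.2.

Definition free_on (B : I -> V) (Q : pred I) : Prop :=
  forall (ms : seq I) (c : I -> K), uniq ms -> all Q ms ->
    \sum_(i <- ms) c i *: B i = 0 -> {in ms, forall i, c i = 0}.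

Implicit Types (B E : I -> V) (Q : pred I).

Lemma spans0 B Q : spans B Q 0.
Proof. by exists [::]; rewrite ?big_nil. Qed.

Lemma spansD B Q x y : spans B Q x -> spans B Q y -> spans B Q (x + y).
Proof.
move=> [l hl ->] [k hk ->]; exists (l ++ k); first by rewrite all_cat hl.
by rewrite big_cat.
Qed.

Lemma spansZ B Q a x : spans B Q x -> spans B Q (a *: x).
Proof.
move=> [l hl ->]; exists [seq (a * ci.1, ci.2) | ci <- l]; first by rewrite all_map.
by rewrite big_map scaler_sumr; apply: eq_bigr => ci _; rewrite scalerA.
Qed.

Lemma spansB B Q x y : spans B Q x -> spans B Q y -> spans B Q (x - y).
Proof. by move=> hx hy; apply: spansD => //; rewrite -scaleN1r; apply: spansZ. Qed.

Lemma spans_base B Q i : Q i -> spans B Q (B i).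
Proof. by move=> qi; exists [:: (1, i)]; rewrite /= ?qi // big_seq1 scale1r. Qed.

Lemma spans_sum B Q (T : eqType) (s : seq T) (F : T -> V) :
  {in s, forall t, spans B Q (F t)} -> spans B Q (\sum_(t <- s) F t).
Proof.
move=> h; rewrite big_seq; elim/big_ind: _ => //; [exact: spans0|exact: spansD].
Qed.

Lemma spans_sub B Q Q' x : {subset Q <= Q'} -> spans B Q x -> spans B Q' x.
Proof. by move=> h [l hl ->]; exists l => //; apply: sub_all hl => ci; apply: h. Qed.

(** Collecting equal indices turns a formal combination into one over distinct
    indices; the coefficients do not involve the vectors, so the same
    regrouping applies to every family [h] with the same index type. *)
Lemma spans_group (W : lmodType K) (l : seq (K * I)) (h : I -> W) :
  \sum_(ci <- l) ci.1 *: h ci.2 =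
  \sum_(i <- undup (map snd l)) (\sum_(ci <- l | ci.2 == i) ci.1) *: h i.
Proof.
rewrite (eq_big_seq (fun ci => \sum_(i <- undup (map snd l) | ci.2 == i) ci.1 *: h i)).
  rewrite (exchange_big_dep predT) //=; apply: eq_bigr => i _.
  by rewrite scaler_suml.
move=> ci cl; rewrite big_mkcond (bigD1_seq ci.2) /= ?undup_uniq ?mem_undup ?map_f //.
by rewrite eqxx big1 ?addr0 // => i; rewrite eq_sym => /negPf->.
Qed.

Lemma spans_uniq B Q x : spans B Q x -> exists (ms : seq I) (c : I -> K),
  [/\ uniq ms, all Q ms & x = \sum_(i <- ms) c i *: B i].
Proof.
move=> [l /allP hl ->]; exists (undup (map snd l)), (fun i => \sum_(ci <- l | ci.2 == i) ci.1).
split; rewrite ?undup_uniq ?spans_group //.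
by apply/allP => i; rewrite mem_undup => /mapP[ci /hl + ->].
Qed.

(** A relation between vectors of a free family has zero coefficients once
    equal indices are collected, hence holds for any other family in its place.
    This is what makes [linear_extension] well defined. *)
Lemma free_extend B Q (W : lmodType K) (h : I -> W) (l : seq (K * I)) :
  free_on B Q -> all (fun ci => Q ci.2) l ->
  \sum_(ci <- l) ci.1 *: B ci.2 = 0 -> \sum_(ci <- l) ci.1 *: h ci.2 = 0.
Proof.
move=> fB /allP hl; rewrite !spans_group => e; rewrite big_seq big1 // => i il.
rewrite [X in X *: _](fB _ (fun i => \sum_(ci <- l | ci.2 == i) ci.1) _ _ e) ?scale0r //.
  exact: undup_uniq.
by apply/allP => j; rewrite mem_undup => /mapP[ci /hl + ->].
Qed.

Lemma linear_extension B Q (W : lmodType K) (h : I -> W) :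
  free_on B Q -> (forall x, spans B Q x) ->
  exists T : V -> W, (forall a x y, T (a *: x + y) = a *: T x + T y) /\
    {in Q, forall i, T (B i) = h i}.
Proof.
move=> fB sB.
have sB' x : exists l : seq (K * I), all (fun ci => Q ci.2) l /\
    x = \sum_(ci <- l) ci.1 *: B ci.2.
  by have [l h1 h2] := sB x; exists l.
have [l hl] := choice sB'.
pose T x := \sum_(ci <- l x) ci.1 *: h ci.2.
have TE x k : all (fun ci => Q ci.2) k -> x = \sum_(ci <- k) ci.1 *: B ci.2 ->
    T x = \sum_(ci <- k) ci.1 *: h ci.2.
  move=> hk ek; have [hlx elx] := hl x.
  have := @free_extend B Q W h (l x ++ [seq (- ci.1, ci.2) | ci <- k]) fB.
  rewrite all_cat hlx all_map /= !big_cat /= !big_map /= => /(_ hk).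
  have sN (U : lmodType K) (g : I -> U) :
      \sum_(ci <- k) - ci.1 *: g ci.2 = - \sum_(ci <- k) ci.1 *: g ci.2.
    by rewrite -sumrN; apply: eq_bigr => ci _; rewrite scaleNr.
  by rewrite !sN -elx -ek subrr => /(_ erefl)/eqP; rewrite subr_eq0 => /eqP.
exists T; split.
  move=> a x y; have [hx ex] := hl x; have [hy ey] := hl y.
  rewrite (TE _ ([seq (a * ci.1, ci.2) | ci <- l x] ++ l y)).
  - rewrite big_cat big_map /=; congr (_ + _).
    by rewrite scaler_sumr; apply: eq_bigr => ci _; rewrite scalerA.
  - by rewrite all_cat all_map hx.
  - rewrite big_cat big_map /= -ey {1}ex; congr (_ + _).
    by rewrite scaler_sumr; apply: eq_bigr => ci _; rewrite scalerA.
move=> i Qi; rewrite (TE _ [:: (1, i)]) ?big_seq1 ?scale1r //=.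
by rewrite andbT.
Qed.

Lemma linear_eq_spans B Q (W : lmodType K) (T U : V -> W) x :
  (forall a x y, T (a *: x + y) = a *: T x + T y) ->
  (forall a x y, U (a *: x + y) = a *: U x + U y) ->
  {in Q, forall i, T (B i) = U (B i)} -> spans B Q x -> T x = U x.
Proof.
move=> hT hU e [l + ->].
have z (F : V -> W) : (forall a x y, F (a *: x + y) = a *: F x + F y) -> F 0 = 0.
  move=> hF; have := hF (-1) 0 0; rewrite scaler0 addr0 scaleN1r => ->.
  by rewrite addNr.
elim: l => [|ci l IHl] /=; first by rewrite big_nil !z.
by move=> /andP[Qi /IHl h]; rewrite big_cons hT hU h e.
Qed.

Lemma exists_maximal (r : rel I) (s : seq I) : irreflexive r -> transitive r ->
  s != [::] -> exists2 i, i \in s & {in s, forall j, ~~ r i j}.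
Proof.
move=> ri rt; elim: s => // a s IHs _; have [->|/IHs[i si im]] := eqVneq s [::].
  by exists a; rewrite ?mem_head // => j; rewrite inE => /eqP->; rewrite ri.
have [ria|nria] := boolP (r i a).
  exists a; rewrite ?mem_head // => j; rewrite inE => /orP[/eqP->|/im]; rewrite ?ri //.
  by apply: contra; apply: rt.
exists i; rewrite ?inE ?si ?orbT // => j; rewrite inE => /orP[/eqP->|/im] //.
Qed.

(** The matrix [k i (E j)] is triangular for [r] with nonzero diagonal. In a
    vanishing combination, apply [k i] for an [r]-maximal index [i] among those
    with nonzero coefficient: only the term of [i] survives. *)
Lemma free_triangular E Q (r : rel I) (k : I -> V -> K) :
  irreflexive r -> transitive r ->
  (forall i a x y, k i (a *: x + y) = a * k i x + k i y) ->
  {in Q, forall i, k i (E i) != 0} ->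
  {in Q &, forall i j, k i (E j) != 0 -> j = i \/ r i j} ->
  free_on E Q.
Proof.
move=> ri rt kl kd ku ms c ums /allP hms e.
pose A := [seq i <- ms | c i != 0].
have [A0|A0] := eqVneq A [::].
  move=> i ims; apply/eqP/negPn/negP => ci.
  have : i \in A by rewrite mem_filter ci ims.
  by rewrite A0.
have [i] := exists_maximal ri rt A0; rewrite mem_filter => /andP[ci ims] im.
have k0 : k i 0 = 0.
  have /eqP := kl i 1 0 0; rewrite scaler0 addr0 mul1r.
  by rewrite -{1}[k i 0]addr0 (inj_eq (addrI _)) eq_sym => /eqP.
have ks s : k i (\sum_(j <- s) c j *: E j) = \sum_(j <- s) c j * k i (E j).
  by elim: s => [|j s IHs]; rewrite ?big_nil // !big_cons kl IHs.
have := ks ms; rewrite e k0 (bigD1_seq i) //= big_seq_cond big1.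
  by rewrite addr0 => /esym/eqP; rewrite mulf_eq0 (negPf ci) (negPf (kd _ (hms _ ims))).
move=> j /andP[jms ji]; apply/eqP; rewrite mulf_eq0; have [//|cj /=] := eqVneq (c j) 0.
apply/negPn/negP => /(ku _ _ (hms _ ims) (hms _ jms))[/eqP|].
  by rewrite (negPf ji).
by apply/negP/im; rewrite mem_filter cj.
Qed.

(** Well-founded substitution: [B i] is [E i] up to vectors [B j] with [f j]
    smaller. *)
Lemma spans_triangular B E Q (r : rel I) (f : I -> nat) :
  {in Q, forall i, spans B [pred j | Q j && r i j] (E i - B i)} ->
  {in Q &, forall i j, r i j -> (f j < f i)%N} ->
  {in Q, forall i, spans E Q (B i)}.
Proof.
move=> h fr i; have [m] := ubnP (f i); elim: m i => // m IHm i; rewrite ltnS => fm Qi.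
rewrite -[B i](subKr (E i)); apply: spansB; first exact: spans_base.
have [l /allP hl ->] := h i Qi; apply: spans_sum => ci /hl /= /andP[Qj rij].
by apply/spansZ/IHm => //; apply: leq_trans fm; apply: fr.
Qed.

Lemma spans_trans B E Q R x :
  spans B Q x -> {in Q, forall i, spans E R (B i)} -> spans E R x.
Proof.
by move=> [l /allP hl ->] h; apply: spans_sum => ci /hl Qi; apply/spansZ/h.
Qed.

(** More vectors than there are values of [tau] on [Q] are dependent: [tau]
    identifies the indices in [Q] with columns of a matrix that has more rows
    than columns. *)
Lemma dependent_count B Q (S T : finType) (tau : I -> T) (v : S -> V) :
  {in Q &, injective tau} -> (forall s, spans B Q (v s)) -> (#|T| < #|S|)%N ->
  exists2 c : S -> K, exists s, c s != 0 & \sum_s c s *: v s = 0.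
Proof.
move=> tinj vs lt.
have D' t : exists d : V, forall i, Q i -> tau i = t -> d = B i.
  have [[i [Qi ti]]|n] := pselect (exists i, Q i /\ tau i = t).
    by exists (B i) => j Qj tj; congr B; apply: tinj => //; rewrite ti.
  by exists 0 => i Qi ti; case: n; exists i.
have [D hD] := choice D'.
have M' s : exists m : T -> K, v s = \sum_t m t *: D t.
  have [l /allP hl ->] := vs s.
  exists (fun t => \sum_(ci <- l | tau ci.2 == t) ci.1).
  rewrite (eq_bigr (fun t => \sum_(ci <- l | tau ci.2 == t) ci.1 *: D t)); last first.
    by move=> t _; rewrite scaler_suml.
  rewrite (exchange_big_dep predT) //=; apply: eq_big_seq => ci cl.
  rewrite (bigD1 (tau ci.2)) //= big1 ?addr0 => [|t /andP[/eqP->]]; last by rewrite eqxx.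
  by rewrite (hD _ ci.2) // hl.
have [M hM] := choice M'.
pose A : 'M[K]_(#|S|, #|T|) := \matrix_(i, j) M (enum_val i) (enum_val j).
have /rowV0Pn[u /sub_kermxP uA u0] : kermx A != 0.
  rewrite kermx_eq0 /row_free neq_ltn (leq_ltn_trans (rank_leq_col A)) //.
exists (fun s => u 0 (enum_rank s)).
  have /rV0Pn[i ui] := u0; exists (enum_val i); by rewrite enum_valK.
under eq_bigr => s _ do rewrite hM scaler_sumr.
rewrite exchange_big big1 //= => t _.
under eq_bigr => s _ do rewrite scalerA.
rewrite -scaler_suml (_ : \sum_s _ = 0) ?scale0r //.
have := congr1 (fun w : 'rV_ _ => w 0 (enum_rank t)) uA; rewrite !mxE => uA0; rewrite -[RHS]uA0.
rewrite (reindex (@enum_val S predT)) /=.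
  apply: eq_bigr => i _; rewrite mxE enum_valK enum_rankK //.
exists enum_rank => s _; rewrite ?enum_rankK ?enum_valK //.
Qed.

End Spans.

(** * Multichains of intervals and their corners *)

Section IntervalPoset.

Variables (disp : Order.disp_t) (P : finPOrderType disp) (fi se : P -> nat).

(** An element [p] is thought of as the interval of integers from [fi p] to [se
    p]; the family is closed under subintervals with at least two elements, and
    the order compares both endpoints. *)
Record interval_poset : Prop := IntervalPoset {
  ip_lt : forall p, (fi p < se p)%N;
  ip_le : forall p q : P, (p <= q)%O = (fi p <= fi q)%N && (se p <= se q)%N;
  ip_sub : forall p i j, (fi p <= i)%N -> (i < j)%N -> (j <= se p)%N ->
    exists2 q, fi q = i & se q = j }.

Hypothesis IP : interval_poset.

Definition lev (p : P) : nat := (fi p + se p)%N.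
Definition strictly_inside (x y : P) := (fi y < fi x)%N && (se x < se y)%N.

Lemma ip_inj p q : fi p = fi q -> se p = se q -> p = q.
Proof. by move=> f s; apply: le_anti; rewrite !(ip_le IP) f s !leqnn. Qed.

Lemma ip_comparable p q :
  (p >=< q)%O = ~~ (strictly_inside p q || strictly_inside q p).
Proof.
rewrite /Order.comparable !(ip_le IP) /strictly_inside.
by apply/idP/idP; lia.
Qed.

(** Distinct elements of one level are nested, hence incomparable. *)
Lemma ip_lev_inj p q : (p >=< q)%O -> lev p = lev q -> p = q.
Proof.
rewrite ip_comparable /strictly_inside /lev => h e.
by apply: ip_inj; lia.
Qed.

Definition chain_seq (s : seq P) := {in s &, forall x y, (x >=< y)%O}.

Definition lev_sort (s : seq P) := sort (fun x y => lev x <= lev y)%N s.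

Lemma multichain_chain s : multichain s -> chain_seq s.
Proof.
move=> h x y xs ys.
have [i [j [ii ij ex ey]]] : exists i j, [/\ i < size s, j < size s, x = nth x s i & y = nth x s j]%N.
  by exists (index x s), (index y s); rewrite !index_mem !nth_index.
have /(sorted_leq_nth le_trans le_refl x) H := h.
have [k|k] := leqP i j.
  by rewrite /Order.comparable ex ey H.
by rewrite /Order.comparable ex ey (H j i) ?orbT // ltnW.
Qed.

Lemma chain_multichain s : chain_seq s -> multichain (lev_sort s).
Proof.
move=> h; have : sorted (fun x y => lev x <= lev y)%N (lev_sort s).
  by apply: sort_sorted => x y; apply: leq_total.
apply: (@sub_in_sorted _ (mem s)); last by apply/allP => x; rewrite mem_sort.
move=> x y xs ys e; have := h _ _ xs ys; rewrite ip_comparable /strictly_inside.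
by rewrite (ip_le IP); move: e; rewrite /lev; lia.
Qed.

Lemma perm_lev_sort s : perm_eq (lev_sort s) s.
Proof. by rewrite perm_sort. Qed.

Lemma multichain_perm (s t : seq P) : multichain s -> multichain t -> perm_eq s t -> s = t.
Proof. exact: le_sorted_eq. Qed.

Lemma lev_multichain (s : seq P) : multichain s -> sorted leq (map lev s).
Proof.
move=> h; rewrite sorted_map; apply: sub_sorted h => x y.
by rewrite (ip_le IP) /lev /=; lia.
Qed.

Lemma lev_perm (s t : seq P) : multichain s -> multichain t ->
  perm_eq (map lev s) (map lev t) -> map lev s = map lev t.
Proof.
move=> /lev_multichain hs /lev_multichain ht.
by move=> e; apply: (sorted_eq leq_trans anti_leq hs ht e).
Qed.

(** Place [x] in row [fi x] and column [se x] of a square grid. A multichain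
    becomes a set of points on a monotone lattice path above the diagonal, and
    an outer corner is a point that is first in its column and last in its row.
    The bound 3 says that the interval from [fi x + 1] to [se x - 1] is still
    an element, so that the corner could be replaced by a point of the same
    level closer to the diagonal. *)
Definition outer_corner (s : seq P) (x : P) :=
  [&& (fi x + 3 <= se x)%N,
      all (fun y => (se y == se x) ==> (fi x <= fi y)%N) s &
      all (fun y => (fi y == fi x) ==> (se y <= se x)%N) s].

Definition corners (s : seq P) := [seq x <- undup s | outer_corner s x].

Lemma corners_uniq s : uniq (corners s).
Proof. exact/filter_uniq/undup_uniq. Qed.

Lemma mem_corners s x : (x \in corners s) = outer_corner s x && (x \in s).
Proof. by rewrite mem_filter mem_undup. Qed.

Lemma cornerP s x : reflect
  [/\ x \in s, (fi x + 3 <= se x)%N,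
      {in s, forall y, se y = se x -> (fi x <= fi y)%N} &
      {in s, forall y, fi y = fi x -> (se y <= se x)%N}] (x \in corners s).
Proof.
rewrite mem_corners; apply: (iffP andP).
  move=> [/and3P[h /allP h1 /allP h2] xs]; split=> // y ys e.
    by have := h1 y ys; rewrite e eqxx.
  by have := h2 y ys; rewrite e eqxx.
move=> [xs h h1 h2]; split=> //; apply/and3P; split=> //; apply/allP => y ys.
  by apply/implyP => /eqP; apply: h1.
by apply/implyP => /eqP; apply: h2.
Qed.

Lemma corners_eq_mem s t : s =i t -> corners s =i corners t.
Proof.
by move=> e x; rewrite !mem_corners /outer_corner e !(eq_all_r e).
Qed.

Lemma corners_perm s t : perm_eq s t -> perm_eq (corners s) (corners t).
Proof.
move=> /perm_mem e; apply: uniq_perm; rewrite ?corners_uniq //.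
exact: corners_eq_mem.
Qed.

Lemma subseq_corners s : subseq (corners s) s.
Proof. exact: subseq_trans (filter_subseq _ _) (undup_subseq _). Qed.

(** The widest element of [s] that contains [y] is a corner: an element
    preceding it in its column, or following it in its row, would be wider and
    still contain [y]. *)
Lemma corner_around s y : y \in s -> (fi y + 3 <= se y)%N ->
  exists2 x, x \in corners s & (fi x <= fi y)%N && (se y <= se x)%N.
Proof.
move=> ys hy.
pose A := [pred x | [&& x \in s, fi x <= fi y & se y <= se x]%N].
have Ay : A y by rewrite inE ys !leqnn.
have [x /and3P[xs xf xe] xm] := arg_maxnP (fun x => se x - fi x)%N Ay.
exists x; last by rewrite xf.
apply/cornerP; split=> // [||]; first lia.
  move=> z zs e; rewrite leqNgt; apply/negP => l.
  have /xm : A z by rewrite inE zs e xe andbT /=; lia.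
  by have := ip_lt IP x; have := ip_lt IP z; lia.
move=> z zs e; rewrite leqNgt; apply/negP => l.
have /xm : A z by rewrite inE zs e xf /=; lia.
by have := ip_lt IP x; have := ip_lt IP z; lia.
Qed.

(** Among the elements of a given level that are comparable with all corners of
    [s], the one lying in [s] is closest to the diagonal, since a closer one
    would lie strictly inside a corner by [corner_around]. *)
Lemma corners_innermost (s t : seq P) x y : multichain t -> {subset corners s <= t} ->
  x \in s -> y \in t -> lev x = lev y -> (fi y <= fi x)%N.
Proof.
move=> /multichain_chain ct st xs yt e; rewrite leqNgt; apply/negP => l.
have ly := ip_lt IP y.
have [|z zc /andP[z1 z2]] := @corner_around s x xs; first by move: e; rewrite /lev; lia.
have := ct _ _ (st _ zc) yt; rewrite ip_comparable /strictly_inside.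
by move: e; rewrite /lev; lia.
Qed.

Definition width (s : seq P) := (\sum_(x <- s) (se x - fi x))%N.

(** A multichain is thus determined by its levels and its corners, and it is
    the narrowest of the multichains with these levels that contain its
    corners. *)
Lemma corners_width (s t : seq P) : multichain t -> {subset corners s <= t} ->
  map lev s = map lev t -> s = t \/ (width s < width t)%N.
Proof.
move=> ht st.
have H x y : x \in s -> y \in t -> lev x = lev y -> (fi y <= fi x)%N.
  exact: corners_innermost.
rewrite /width; elim: s t {ht st} H => [|x s IHs] [|y t] //= H; first by left.
move=> [e /(IHs t)]; case.
- by move=> a b ha hb; apply: H; rewrite inE ?ha ?hb orbT.
- move=> ->; have := H x y; rewrite !inE !eqxx => /(_ isT isT e).
  rewrite leq_eqVlt => /orP[/eqP f|f]; [left|right].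
    by congr (_ :: _); apply: ip_inj => //; move: e; rewrite /lev; lia.
  rewrite !big_cons; move: e; rewrite /lev.
  by have := ip_lt IP x; have := ip_lt IP y; lia.
- move=> w; right; rewrite !big_cons.
  have := H x y; rewrite !inE !eqxx => /(_ isT isT e).
  by move: e; rewrite /lev; have := ip_lt IP x; have := ip_lt IP y; lia.
Qed.

(** Start from elements of the level of [p] that contain no element of [s]
    strictly, such as the innermost one, and take the outermost of them. If an
    element [x] of [s] contained it strictly, widening it by one would stay
    within [x] and would have to create a new strict inclusion, contradicting
    that [s] is a chain. *)
Lemma level_comparable s p : chain_seq s ->
  exists2 y, lev y = lev p & {in s, forall x, (x >=< y)%O}.
Proof.
move=> cs.
pose N := [pred y | (lev y == lev p) && all (fun x => ~~ strictly_inside x y) s].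
have [y0 Ny0] : exists y0, N y0.
  pose L := [pred y | lev y == lev p].
  have Lp : L p by rewrite inE.
  have [y0 /eqP y0l y0m] := arg_maxnP fi Lp.
  exists y0; rewrite inE y0l eqxx /=; apply/allP => x xs; apply/negP => /andP[h1 h2].
  have hx := ip_lt IP x.
  have [|||z z1 z2] := @ip_sub IP y0 (fi y0).+1 (se y0).-1; try lia.
  have /y0m : L z by rewrite inE -y0l /lev z1 z2; lia.
  by rewrite z1; lia.
have [y /andP[/eqP yl /allP yn] ym] := arg_minnP fi Ny0.
exists y => // x xs; rewrite ip_comparable negb_or yn //=.
apply/negP => /andP[h1 h2].
have hy := ip_lt IP y.
have [|||z z1 z2] := @ip_sub IP x (fi y).-1 (se y).+1; try lia.
have lz : lev z = lev p by rewrite -yl /lev z1 z2; lia.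
suff /ym : N z by lia.
rewrite inE lz eqxx /=; apply/allP => w ws; apply/negP => /andP[k1 k2].
by have := cs _ _ ws xs; rewrite ip_comparable /strictly_inside; lia.
Qed.

(** Inserting the element of the level that is comparable with [s] and closest
    to the diagonal creates no corner and destroys none: otherwise it could be
    pushed inwards and remain comparable with [s]. If the level occurs in [s]
    already, the element of [s] on it is repeated. In terms of the ring:
    multiplying a basis element by a level sum gives another basis element. *)
Lemma level_insert (s : seq P) p : multichain s -> exists t,
  [/\ multichain t, perm_eq (corners t) (corners s) &
      perm_eq (map lev t) (lev p :: map lev s)].
Proof.
move=> hs; have cs := multichain_chain hs.
suff [y [yl yc ycn]] : exists y, [/\ lev y = lev p, {in s, forall x, (x >=< y)%O} &
   corners (y :: s) =i corners s].
  exists (lev_sort (y :: s)); split.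
  - apply: chain_multichain => a b; rewrite !inE.
    move=> /orP[/eqP->|ha] /orP[/eqP->|hb]; rewrite ?comparablexx ?yc //; last exact: cs.
    by rewrite comparable_sym yc.
  - apply: (perm_trans (corners_perm (perm_lev_sort _))).
    by apply: uniq_perm; rewrite ?corners_uniq.
  - by rewrite -yl (perm_map lev (perm_lev_sort (y :: s))).
have [/hasP[y ys /eqP yl]|/hasPn nl] := boolP (has (fun y => lev y == lev p) s).
  exists y; split=> // [x xs|]; first exact: cs.
  by apply: corners_eq_mem => z; rewrite inE; case: eqP => // ->.
have [y0 y0l y0c] := level_comparable p cs.
pose N := [pred y | (lev y == lev p) && all (fun x => (x >=< y)%O) s].
have Ny0 : N y0 by rewrite inE y0l eqxx; apply/allP.
have [y /andP[/eqP yl /allP yc] ym] := arg_maxnP fi Ny0.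
(* Such a [y] could be moved one step closer to the diagonal. *)
have push : (fi y + 3 <= se y)%N ->
    {in s, forall x, se x = se y -> (fi y <= fi x)%N} ->
    {in s, forall x, fi x = fi y -> (se x <= se y)%N} -> False.
  move=> w hc hr.
  have [|||z z1 z2] := @ip_sub IP y (fi y).+1 (se y).-1; try lia.
  suff /ym : N z by lia.
  have lz : lev z = lev p by rewrite -yl /lev z1 z2; lia.
  rewrite inE lz eqxx; apply/allP => x xs.
  have := yc x xs; have := nl x xs; have := hc x xs; have := hr x xs.
  rewrite -yl !ip_comparable /strictly_inside /lev z1 z2.
  have := ip_lt IP x; have := ip_lt IP y; lia.
have yns : y \notin s by apply/negP => /nl; rewrite yl eqxx.
exists y; split=> // x; apply/cornerP/cornerP => -[xs x2 x3 x4].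
  move: xs; rewrite inE => /orP[/eqP e|xs].
    subst x; case: push => // x xs.
      by apply: x3; rewrite inE xs orbT.
    by apply: x4; rewrite inE xs orbT.
  by split=> // z zs; [apply: x3|apply: x4]; rewrite inE zs orbT.
split=> //; first by rewrite inE xs orbT.
  move=> z; rewrite inE => /orP[/eqP -> e|]; last exact: x3.
  rewrite leqNgt; apply/negP => l; apply: push; first lia.
    move=> u us e'; have := x3 u us; lia.
  move=> u us e'; have := cs _ _ us xs.
  by rewrite ip_comparable /strictly_inside; lia.
move=> z; rewrite inE => /orP[/eqP -> e|]; last exact: x4.
rewrite leqNgt; apply/negP => l; apply: push; first lia.
  move=> u us e'; have := cs _ _ us xs.
  by rewrite ip_comparable /strictly_inside; lia.
move=> u us e'; have := x4 u us; lia.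
Qed.

Lemma count_chain s x : chain_seq s -> x \in s ->
  count_mem x s = count (fun y => lev y == lev x) s.
Proof.
move=> cs xs; apply: eq_in_count => y ys /=.
by apply/eqP/eqP => [->//|]; apply: ip_lev_inj; apply: cs.
Qed.

Definition levels : seq nat := undup [seq lev p | p <- enum P].

Lemma mem_levels p : lev p \in levels.
Proof. by rewrite mem_undup map_f // mem_enum. Qed.

Lemma levelsP j : j \in levels -> exists p, j = lev p.
Proof. by rewrite mem_undup => /mapP[p _ ->]; exists p. Qed.

(** A multichain is determined by its support and by its number of elements on
    each level, because a multichain meets a level in at most one point. Hence
    the number of multichains of length at most [M] is of order at most [M ^
    size levels]. *)
Lemma multichain_code M : exists tau : seq P ->
    ({set P} * {ffun 'I_(size levels) -> 'I_M.+1})%type,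
  {in [pred s | multichain s && (size s <= M)%N] &, injective tau}.
Proof.
exists (fun s => ([set x in s], [ffun i : 'I_(size levels) =>
  inord (count (fun y => lev y == nth 0%N levels i) s) : 'I_M.+1])).
move=> s t /andP[hs sM] /andP[ht tM] [e1 e2].
have st : s =i t by move=> x; have := congr1 (fun A : {set P} => x \in A) e1; rewrite !inE.
apply: multichain_perm => //.
have E x : x \in s -> count_mem x s = count_mem x t.
  move=> xs; rewrite !count_chain -?st //; try exact: multichain_chain.
  have hi : (index (lev x) levels < size levels)%N by rewrite index_mem mem_levels.
  have := congr1 (fun f : {ffun _ -> _} => f (Ordinal hi)) e2; rewrite !ffunE /=.
  rewrite nth_index ?mem_levels // => /(congr1 val); rewrite /= !inordK //.
    by rewrite ltnS (leq_trans (count_size _ _)).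
  by rewrite ltnS (leq_trans (count_size _ _)).
by apply/allP => x; rewrite mem_cat -st orbb => /E e; apply/eqP.
Qed.

End IntervalPoset.

(** * Straightening modulo the three-term relations *)

Section Straightening.

Variables (K : fieldType) (disp : Order.disp_t) (P : finPOrderType disp).
Variables (fi se : P -> nat).
Hypothesis IP : interval_poset fi se.

(** The quantity that every straightening step increases. *)
Definition spread (s : seq P) := (\sum_(x <- s) (lev fi se x) ^ 2)%N.

Lemma chain_seqPn (s : seq P) :
  chain_seq s \/ exists x y, [/\ x \in s, y \in s & ~~ (x >=< y)%O].
Proof.
have [/allrelP h|] := boolP (all2rel (fun x y : P => (x >=< y)%O) s); first by left.
by move=> /allPn[x xs /allPn[y ys nc]]; right; exists x, y.
Qed.

Lemma spread_perm s t : perm_eq s t -> spread s = spread t.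
Proof. exact: perm_big. Qed.

Definition lev_bound := (\max_(p : P) lev fi se p)%N.

Lemma spread_bound s : (spread s <= size s * lev_bound ^ 2)%N.
Proof.
rewrite /spread; elim: s => [|x s IHs]; first by rewrite big_nil.
rewrite big_cons /= mulSn leq_add // leq_exp2r //.
by rewrite /lev_bound (leq_bigmax (F := lev fi se)).
Qed.

Variables (S : comAlgType K) (psi : P -> S) (I : {pred S}).

Hypothesis I0 : 0 \in I.
Hypothesis ID : {in I &, forall a b, a + b \in I}.
Hypothesis IM : forall a b, b \in I -> a * b \in I.

(** With [a < b < c < d] the endpoints of the nested intervals [ad] and [bc],
    this is the three-term relation [p_ad p_bc - p_ac p_bd + p_ab p_cd = 0],
    modulo [I]. The ideal is a parameter because the relation is used both in
    the algebra, with [I = 0], and in the polynomial ring modulo its quadrics.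
    *)
Definition plucker_mod := forall ad bc ac bd ab cd : P,
  strictly_inside fi se bc ad ->
  fi ac = fi ad -> se ac = se bc -> fi bd = fi bc -> se bd = se ad ->
  fi ab = fi ad -> se ab = fi bc -> fi cd = se bc -> se cd = se ad ->
  psi ad * psi bc - psi ac * psi bd + psi ab * psi cd \in I.

Hypothesis plucker : plucker_mod.

Definition spans_mod (Q : pred (seq P)) (x : S) :=
  exists2 y, spans (std_monomial psi) Q y & x - y \in I.

Lemma modZ (a : K) b : b \in I -> a *: b \in I.
Proof. by move=> bI; rewrite -mulr_algl IM. Qed.

Lemma spans_modD Q x y : spans_mod Q x -> spans_mod Q y -> spans_mod Q (x + y).
Proof.
move=> [x' hx ex] [y' hy ey]; exists (x' + y'); first exact: spansD.
by rewrite opprD addrACA ID.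
Qed.

Lemma spans_modZ Q a x : spans_mod Q x -> spans_mod Q (a *: x).
Proof.
move=> [x' hx ex]; exists (a *: x'); first exact: spansZ.
by rewrite -scalerBr modZ.
Qed.

Lemma spans_mod_eq Q x y : x - y \in I -> spans_mod Q y -> spans_mod Q x.
Proof.
move=> xy [z hz ez]; exists z => //.
by rewrite -[x](subrK y) -addrA ID.
Qed.

Lemma std_monomial_perm (s t : seq P) :
  perm_eq s t -> std_monomial psi s = std_monomial psi t.
Proof. exact: perm_big. Qed.

(** Both replacements of a nested pair push the two levels apart: the endpoints
    that occur are the same, so [spread] changes with the sum of [2 * fi * se],
    which grows. *)
Lemma plucker_step s x y : x \in s -> y \in s -> ~~ (x >=< y)%O ->
  exists s1 s2, [/\ size s1 = size s, size s2 = size s,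
    (spread s < spread s1)%N, (spread s < spread s2)%N &
    std_monomial psi s - (std_monomial psi s1 - std_monomial psi s2) \in I].
Proof.
wlog yx : x y / strictly_inside fi se y x.
  move=> W xs ys nc; have := nc; rewrite (ip_comparable IP) negbK => /orP[] h.
    by apply: (W y x) => //; rewrite comparable_sym.
  exact: (W x y).
move=> xs ys nc.
have yx' : y \in rem x s.
  by have := ys; rewrite (perm_mem (perm_to_rem xs)) inE => /orP[/eqP e|//];
    move: nc; rewrite e comparablexx.
pose t := rem y (rem x s).
have p : perm_eq s (x :: y :: t).
  by apply: (perm_trans (perm_to_rem xs)); rewrite perm_cons perm_to_rem.
rewrite (spread_perm p) (std_monomial_perm p) (perm_size p).
have /andP[h1 h2] := yx.
have hx := ip_lt IP x; have hy := ip_lt IP y.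
have [||| ac ac1 ac2] := @ip_sub _ _ _ _ IP x (fi x) (se y); try lia.
have [||| bd bd1 bd2] := @ip_sub _ _ _ _ IP x (fi y) (se x); try lia.
have [||| ab ab1 ab2] := @ip_sub _ _ _ _ IP x (fi x) (fi y); try lia.
have [||| cd cd1 cd2] := @ip_sub _ _ _ _ IP x (se y) (se x); try lia.
exists (ac :: bd :: t), (ab :: cd :: t); split=> //.
- rewrite /spread !big_cons /lev ac1 ac2 bd1 bd2 !addnA ltn_add2r; nia.
- rewrite /spread !big_cons /lev ab1 ab2 cd1 cd2 !addnA ltn_add2r; nia.
have := plucker yx ac1 ac2 bd1 bd2 ab1 ab2 cd1 cd2.
move=> /(IM (std_monomial psi t)); rewrite /std_monomial !big_cons.
by congr (_ \in I); ring.
Qed.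

Lemma spans_mod_sub Q Q' x : {subset Q <= Q'} -> spans_mod Q x -> spans_mod Q' x.
Proof. by move=> h [y hy ey]; exists y => //; apply: spans_sub hy. Qed.

Lemma spans_modB Q x y : spans_mod Q x -> spans_mod Q y -> spans_mod Q (x - y).
Proof.
by move=> hx hy; apply: spans_modD => //; rewrite -scaleN1r; apply: spans_modZ.
Qed.

(** Repeated use of [plucker_step] stops because [spread] is bounded on
    products of given length. *)
Lemma straighten_le s :
  spans_mod [pred t | [&& multichain t, size t == size s & (spread s <= spread t)%N]]
    (std_monomial psi s).
Proof.
have [m] := ubnP (size s * lev_bound ^ 2 - spread s)%N.
elim: m s => // m IHm s; rewrite ltnS => hm.
have [cs|[x [y [xs ys nc]]]] := chain_seqPn s.
  exists (std_monomial psi (lev_sort fi se s)).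
    apply: spans_base; rewrite inE (chain_multichain IP) // size_sort eqxx /=.
    by rewrite (spread_perm (perm_lev_sort _ _ s)).
  by rewrite (std_monomial_perm (perm_lev_sort _ _ s)) subrr.
have [s1 [s2 [z1 z2 k1 k2 e]]] := plucker_step xs ys nc.
have G s' : size s' = size s -> (spread s < spread s')%N ->
  spans_mod [pred t | [&& multichain t, size t == size s & (spread s <= spread t)%N]]
    (std_monomial psi s').
  move=> z k; have b := spread_bound s'; rewrite z in b.
  apply: spans_mod_sub (IHm s' _); last by rewrite z; lia.
  by move=> t; rewrite !inE z => /and3P[-> -> h] /=; lia.
by apply: (spans_mod_eq e); apply: spans_modB; apply: G.
Qed.

Lemma straighten_lt s x y : x \in s -> y \in s -> ~~ (x >=< y)%O ->
  spans_mod [pred t | [&& multichain t, size t == size s & (spread s < spread t)%N]]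
    (std_monomial psi s).
Proof.
move=> xs ys nc; have [s1 [s2 [z1 z2 k1 k2 e]]] := plucker_step xs ys nc.
apply: (spans_mod_eq e); apply: spans_modB;
  apply: spans_mod_sub (straighten_le _) => t; rewrite !inE ?z1 ?z2 => /and3P[-> -> h] /=;
  lia.
Qed.

End Straightening.

(** * Freeness over the level sums *)

Section HodgeBasis.

Variables (K : fieldType) (disp : Order.disp_t) (P : finPOrderType disp).
Variables (fi se : P -> nat).
Hypothesis IP : interval_poset fi se.
Variables (R : comAlgType K) (phi : P -> R).

Local Notation std := (std_monomial phi).
Local Notation lev := (lev fi se).
Local Notation corners := (corners fi se).
Local Notation mchain := (fun s : seq P => multichain s).

Hypothesis plucker : plucker_mod fi se phi [pred x | x == 0].
Hypothesis std_free : free_on std mchain.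
Hypothesis std_span : forall x, spans std mchain x.

(** The parameter of level [j]. *)
Definition theta (j : nat) : R := \sum_(p : P | lev p == j) phi p.

(** The levels, with multiplicity, that are left over when each corner is
    removed once from the multichain. *)
Definition rest (s : seq P) : seq nat :=
  map lev (sval (perm_to_subseq (subseq_corners fi se s))).

Definition hodge_prod (w : seq P) (t : seq nat) : R :=
  std w * \prod_(j <- t) theta j.

(** Over all multichains these are the products of a monomial in the [theta]'s
    with the product of the corners of some multichain. They form a basis, so
    the algebra is free over the polynomial ring in the [theta]'s. *)
Definition hodge_monomial (s : seq P) : R := hodge_prod (corners s) (rest s).

Lemma restP s : exists2 u, perm_eq s (corners s ++ u) & rest s = map lev u.
Proof. by rewrite /rest; case: perm_to_subseq => u hu; exists u. Qed.

Lemma hodge_prod_perm w w' t t' : perm_eq w w' -> perm_eq t t' ->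
  hodge_prod w t = hodge_prod w' t'.
Proof.
by move=> hw ht; rewrite /hodge_prod (std_monomial_perm phi hw) (perm_big _ ht).
Qed.

(** Multiplication by [theta (lev p)], read on the indices of the basis. *)
Lemma hodge_insert (s : seq P) p : multichain s -> exists t,
  [/\ multichain t, perm_eq (corners t) (corners s) &
      perm_eq (rest t) (lev p :: rest s)].
Proof.
move=> hs; have [t [ht ct lt]] := level_insert IP p hs; exists t; split=> //.
have [u hu ->] := restP s; have [v hv ->] := restP t.
rewrite -(perm_cat2l (map lev (corners s))).
have e1 : perm_eq (map lev (corners s) ++ map lev v) (map lev t).
  by rewrite perm_sym (permPl (perm_map lev hv)) map_cat perm_cat2r perm_map.
rewrite (permPl e1) (permPl lt) perm_sym -cat1s perm_catCA cat1s perm_cons.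
by rewrite -map_cat perm_sym perm_map.
Qed.

Lemma std_cat s t : std (s ++ t) = std s * std t.
Proof. exact: big_cat. Qed.

(** The terms of the expanded product of level sums: every element of [u] is
    replaced by an arbitrary element of its level. *)
Fixpoint selections (u : seq P) : seq (seq P) :=
  if u is y :: u' then
    [seq p :: t | p <- enum [pred p | lev p == lev y], t <- selections u']
  else [:: [::]].

Lemma selectionsP u t : (t \in selections u) = (map lev t == map lev u).
Proof.
elim: u t => [|y u IHu] [|p t] //=.
  by apply/negbTE/negP => /allpairsPdep[? [? []]].
rewrite eqseq_cons -IHu; apply/allpairsPdep/andP.
  by move=> [q [v [+ hv [-> ->]]]]; rewrite mem_enum.
by move=> [h1 h2]; exists p, t; rewrite mem_enum.
Qed.

Lemma selections_uniq u : uniq (selections u).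
Proof.
elim: u => //= y u IHu; apply: allpairs_uniq => //; first exact: enum_uniq.
by move=> [a b] [c d] _ _ /= [-> ->].
Qed.

Lemma prod_theta u :
  \prod_(j <- map lev u) theta j = \sum_(t <- selections u) std t.
Proof.
elim: u => [|y u IHu] /=; first by rewrite big_nil big_seq1 /std_monomial big_nil.
rewrite big_cons IHu big_allpairs_dep /= /theta big_enum_cond /= mulr_suml.
apply: eq_big => [p|p _]; first by rewrite inE andbT.
by rewrite mulr_sumr; apply: eq_bigr => t _; rewrite /std_monomial big_cons.
Qed.

(** The order for which the change of basis is triangular. Straightening
    increases [spread]; a product that needs no straightening has the same
    levels, and is compared through [width]. *)
Definition precedes (s t : seq P) : bool :=
  (size s == size t) && ((spread fi se s < spread fi se t)%N ||
    (spread fi se s == spread fi se t) && (width fi se s < width fi se t)%N).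

Lemma spread_lev s t : map lev s = map lev t -> spread fi se s = spread fi se t.
Proof.
move=> e; rewrite /spread; have := congr1 (fun l => \sum_(i <- l) i ^ 2)%N e.
by rewrite /= !big_map.
Qed.

Lemma perm_lev_eq (t u : seq P) : chain_seq u -> perm_eq t u ->
  map lev t = map lev u -> t = u.
Proof.
move=> cu p e; have sz := perm_size p.
case: u cu p e sz => [|x0 u] cu p e sz; first by case: t sz p e.
apply: (@eq_from_nth _ x0) => // i hi.
have hi' : (i < size (x0 :: u))%N by rewrite -sz.
apply: (ip_lev_inj IP).
  by apply: cu; rewrite -?(perm_mem p) ?mem_nth // ?(perm_mem p) mem_nth.
by rewrite -(nth_map x0 0%N) // e (nth_map x0).
Qed.

(** Expand the level sums. One term is the multichain [s] itself. Another term
    has the same levels and the corners of [s]: if it is a chain, it is wider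
    by [corners_width], and otherwise straightening increases its spread. *)
Lemma hodge_expand (s : seq P) : multichain s ->
  spans std [pred t | multichain t && precedes s t] (hodge_monomial s - std s).
Proof.
move=> hs; have [u hu eu] := restP s.
have cs := multichain_chain hs.
rewrite /hodge_monomial /hodge_prod eu prod_theta mulr_sumr.
rewrite (std_monomial_perm phi hu) (bigD1_seq u) ?selectionsP ?selections_uniq //=.
rewrite std_cat addrAC subrr add0r.
rewrite -big_filter; apply: spans_sum => t; rewrite mem_filter selectionsP.
move=> /andP[tu /eqP et].
have -> : std (corners s) * std t = std (corners s ++ t).
  by rewrite std_cat.
set v := corners s ++ t.
have lv : perm_eq (map lev v) (map lev s).
  by rewrite perm_sym (permPl (perm_map lev hu)) !map_cat et.
have sv : size v = size s.
  by rewrite -(size_map lev v) (perm_size lv) size_map.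
have spv : spread fi se v = spread fi se s.
  have := perm_big _ lv (op := addn) (x := 0%N) (P := xpredT) (F := fun i => i ^ 2)%N.
  by rewrite !big_map.
have [cv|[x [y [xs ys nc]]]] := chain_seqPn v.
  pose w := lev_sort fi se v; have pw : perm_eq w v := perm_lev_sort fi se v.
  have mw : multichain w := chain_multichain IP cv.
  rewrite -(std_monomial_perm phi pw); apply: spans_base; rewrite inE mw /=.
  have lw : map lev s = map lev w.
    apply: (lev_perm IP) => //; rewrite perm_sym.
    by rewrite (permPl (perm_map lev pw)).
  have [|e|wl] := corners_width IP mw _ lw.
  - by move=> x xc; rewrite (perm_mem pw) mem_cat xc.
  - case/eqP: tu; apply: perm_lev_eq => //.
      by move=> x y xu yu; apply: cs; rewrite (perm_mem hu) mem_cat ?xu ?yu orbT.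
    by move: pw; rewrite -e perm_sym (permPr hu) perm_cat2l.
  by rewrite /precedes wl (perm_size pw) sv (spread_lev lw) !eqxx orbT.
have [z hz /eqP ez] : spans_mod phi [pred x | x == 0] [pred t | multichain t && precedes s t] (std v).
  apply: (spans_mod_sub _ (straighten_lt IP _ _ _ plucker xs ys nc)).
  - move=> w; rewrite !inE => /and3P[-> /eqP zw h] /=.
    by rewrite /precedes zw sv eqxx -spv h.
  - by rewrite inE.
  - by move=> a b; rewrite !inE => /eqP-> /eqP->; rewrite addr0.
  - by move=> a b; rewrite !inE => /eqP->; rewrite mulr0.
by move/eqP: ez; rewrite subr_eq0 => /eqP->.
Qed.

Lemma width_bound s : (width fi se s <= size s * lev_bound fi se)%N.
Proof.
rewrite /width; elim: s => [|x s IHs]; first by rewrite big_nil.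
rewrite big_cons /= mulSn leq_add //.
apply: (@leq_trans (lev x)); first exact: leq_trans (leq_subr _ _) (leq_addl _ _).
exact: (leq_bigmax (F := lev) x).
Qed.

Lemma precedes_irr : irreflexive precedes.
Proof. by move=> s; rewrite /precedes !ltnn /= !andbF. Qed.

Lemma precedes_trans : transitive precedes.
Proof.
rewrite /precedes => t s u /andP[/eqP-> h1] /andP[/eqP-> h2]; rewrite eqxx /=.
move: h1 h2; lia.
Qed.

Lemma hodge_span x : spans hodge_monomial mchain x.
Proof.
apply: spans_trans (std_span x) _.
pose B := lev_bound fi se.
(* A decreasing measure for the lexicographic order: both terms are distances to
   the maximal spread and width for the given length. *)
pose f s := ((size s * B ^ 2 - spread fi se s) * (size s * B).+1 + (size s * B - width fi se s))%N.
apply: (@spans_triangular _ _ _ _ _ _ precedes f); first exact: hodge_expand.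
move=> s t _ _ /andP[/eqP e h]; rewrite /f e.
have := spread_bound fi se s; have := spread_bound fi se t.
have := width_bound s; have := width_bound t; rewrite e -/B.
case/orP: h => [h|/andP[/eqP-> h]]; last lia.
set A := (_ * B ^ 2)%N; set C := (_ * B)%N => h1 h2 h3 h4.
have : (A - spread fi se t < A - spread fi se s)%N by lia.
move: (A - _)%N (A - _)%N => a b; nia.
Qed.

Lemma hodge_free : free_on hodge_monomial mchain.
Proof.
have kP s : exists k : R -> K, (forall a x y, k (a *: x + y) = a * k x + k y) /\
    {in mchain, forall t, k (std t) = (t == s)%:R}.
  have [T [hT eT]] := linear_extension (W := K^o) (fun t => (t == s)%:R) std_free std_span.
  by exists T.
have [k hk] := choice kP.
have kd s : {in mchain, forall t, k s (hodge_monomial t) != 0 -> t = s \/ precedes t s}.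
  move=> t ht; have [kl kb] := hk s.
  have [//|ts] := eqVneq t s; first by left.
  have [//|np] := boolP (precedes t s); first by right.
  have k0 : k s 0 = 0.
    by have := kl (-1) 0 0; rewrite scaler0 addr0 mulN1r addNr.
  rewrite -[hodge_monomial t](subrK (std t)) -[X in k s (X + _)]scale1r kl mul1r.
  rewrite kb // (negPf ts) addr0.
  have -> : k s (hodge_monomial t - std t) = 0; last by rewrite eqxx.
  apply: (linear_eq_spans (W := K^o) kl (U := fun=> 0) _ _ (hodge_expand ht)).
    by move=> a x y; rewrite scaler0 addr0.
  move=> u /andP[hu pu]; rewrite kb //; case: eqP => // e.
  by move: np; rewrite -e pu.
apply: (@free_triangular _ _ _ _ _ (fun s t => precedes t s) k).
- exact: precedes_irr.
- by move=> t s u h1 h2; apply: precedes_trans h2 h1.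
- by move=> s; have [] := hk s.
- move=> s hs; have [kl kb] := hk s.
  rewrite -[hodge_monomial s](subrK (std s)) -[X in k s (X + _)]scale1r kl mul1r.
  rewrite kb // eqxx.
  have -> : k s (hodge_monomial s - std s) = 0; last by rewrite add0r oner_eq0.
  apply: (linear_eq_spans (W := K^o) kl (U := fun=> 0) _ _ (hodge_expand hs)).
    by move=> a x y; rewrite scaler0 addr0.
  move=> u /andP[hu pu]; rewrite kb //; case: eqP => // e.
  by move: pu; rewrite e precedes_irr.
- by move=> s t _ ht; apply: kd.
Qed.

(** The value [g(theta_j)]. *)
Definition at_theta (j : nat) (g : {poly K}) : R := horner_alg (theta j) g.

Lemma at_thetaM j g h : at_theta j (g * h) = at_theta j g * at_theta j h.
Proof. exact: rmorphM. Qed.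

Lemma hodge_prod_split w j t : hodge_prod w t =
  at_theta j 'X^(count_mem j t) * hodge_prod w [seq i <- t | i != j].
Proof.
rewrite /hodge_prod mulrCA; congr (_ * _); rewrite /at_theta rmorphXn /= horner_algX.
rewrite (bigID (pred1 j)) /= big_filter; congr (_ * _).
elim: t => [|i t IHt]; first by rewrite big_nil.
by rewrite big_cons /=; case: eqP => [->|] /=; rewrite IHt ?exprS.
Qed.

Lemma hodge_monomial_theta (s : seq P) p : multichain s -> exists t,
  [/\ multichain t, perm_eq (corners t) (corners s),
      perm_eq (rest t) (lev p :: rest s) &
      hodge_monomial t = theta (lev p) * hodge_monomial s].
Proof.
move=> /(hodge_insert p)[t [h1 h2 h3]]; exists t; split=> //.
by rewrite /hodge_monomial (hodge_prod_perm h2 h3) /hodge_prod big_cons mulrCA.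
Qed.

(** The algebra is free over the polynomials in the [theta]'s. Reducing the
    exponent of [theta_j] modulo [f] on each basis element therefore defines an
    operator that commutes with the other [theta]'s and projects onto a
    complement of the ideal of [f(theta_j)]. *)
Lemma remainder_operator p (f : {poly K}) (j := lev p) : exists rho : R -> R,
  [/\ forall a x y, rho (a *: x + y) = a *: rho x + rho y,
      forall q g x, lev q != j ->
        rho (at_theta (lev q) g * x) = at_theta (lev q) g * rho x,
      forall x, rho (at_theta j f * x) = 0 &
      forall x, exists y, x - rho x = at_theta j f * y].
Proof.
pose c s := count_mem j (rest s).
pose F s := hodge_prod (corners s) [seq i <- rest s | i != j].
have [rho [rl rb]] := linear_extension (fun s => at_theta j ('X^(c s) %% f) * F s)
  hodge_free hodge_span.
have ES s : hodge_monomial s = at_theta j 'X^(c s) * F s by apply: hodge_prod_split.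
have rM g (s : seq P) : multichain s -> rho (at_theta j g * hodge_monomial s) =
    at_theta j ((g * 'X^(c s)) %% f) * F s.
  elim/poly_ind: g s => [|g a IHg] s hs.
    rewrite mul0r mod0p /at_theta !rmorph0 !mul0r.
    by have := rl (-1) 0 0; rewrite scaler0 addr0 scaleN1r addNr.
  have [t [ht ct lt et]] := hodge_monomial_theta p hs.
  have ctE : c t = (c s).+1 by rewrite /c (permP lt) /= eqxx.
  have FtE : F t = F s.
    apply: hodge_prod_perm ct _.
    by rewrite (permPl (perm_filter _ lt)) /= eqxx.
  have -> : at_theta j (g * 'X + a%:P) * hodge_monomial s =
      a *: hodge_monomial s + at_theta j g * hodge_monomial t.
    rewrite {1}/at_theta rmorphD rmorphM /= horner_algX horner_algC et.
    by rewrite mulrDl addrC mulr_algl mulrA.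
  rewrite rl rb // (IHg t) // ctE FtE scalerAl -mulrDl; congr (_ * _).
  rewrite [in RHS]mulrDl modpD mul_polyC modpZl -mul_polyC.
  rewrite /at_theta rmorphD rmorphM /= horner_algC mulr_algl.
  by rewrite addrC exprS mulrA.
have lM a : forall b x y, a * (b *: x + y) = b *: (a * x) + a * y :> R.
  by move=> b x y; rewrite mulrDr -scalerAr.
exists rho; split=> //.
- move=> q g x qj.
  apply: (linear_eq_spans (T := fun x => rho (at_theta (lev q) g * x))
    (U := fun x => at_theta (lev q) g * rho x) _ _ _ (hodge_span x)) => [a y z|a y z|s hs].
  + by rewrite lM rl.
  + by rewrite rl lM.
  elim/poly_ind: g s hs => [|g a IHg] s hs.
    rewrite /at_theta !rmorph0 !mul0r.
    by have := rl (-1) 0 0; rewrite scaler0 addr0 scaleN1r addNr.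
  have [t [ht ct lt et]] := hodge_monomial_theta q hs.
  have ctE : c t = c s by rewrite /c (permP lt) /= (negPf qj).
  have FtE : F t = theta (lev q) * F s.
    rewrite /F (hodge_prod_perm ct (perm_filter _ lt)) /= qj.
    by rewrite /hodge_prod big_cons mulrCA.
  have AE y : at_theta (lev q) (g * 'X + a%:P) * y =
      a *: y + at_theta (lev q) g * (theta (lev q) * y).
    rewrite {1}/at_theta rmorphD rmorphM /= horner_algX horner_algC.
    by rewrite mulrDl addrC mulr_algl mulrA.
  rewrite !AE rl -et (IHg t) //; congr (_ + _ * _).
  by rewrite !rb // FtE ctE mulrCA.
- move=> x; apply: (linear_eq_spans (T := fun x => rho (at_theta j f * x))
    (U := fun=> 0) _ _ _ (hodge_span x)).
  + by move=> a y z; rewrite lM rl.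
  + by move=> a y z; rewrite scaler0 addr0.
  + by move=> s hs; rewrite rM // modp_mulr /at_theta rmorph0 mul0r.
move=> x; have [l /allP hl ->] := hodge_span x.
elim: l hl => [|ci l IHl] hl.
  exists 0; rewrite big_nil mulr0 sub0r.
  have := rl (-1) 0 0; rewrite scaler0 addr0 scaleN1r addNr => ->.
  by rewrite oppr0.
have [|y hy] := IHl; first by move=> z zl; apply: hl; rewrite inE zl orbT.
have hs := hl ci (mem_head _ _).
exists (ci.1 *: (at_theta j ('X^(c ci.2) %/ f) * F ci.2) + y).
rewrite big_cons rl opprD addrACA hy mulrDr; congr (_ + _).
rewrite -scalerBr -scalerAr rb // ES -mulrBl; congr (_ *: _); rewrite [RHS]mulrA; congr (_ * _).
rewrite -at_thetaM /at_theta -rmorphB; congr (horner_alg _ _).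
by rewrite {1}(divp_eq 'X^(c ci.2) f) addrK mulrC.
Qed.

(** The powers of [theta (lev p)] are among the basis elements, so [theta (lev
    p)] is transcendental. *)
Lemma at_theta_neq0 p (f : {poly K}) : f != 0 -> at_theta (lev p) f != 0.
Proof.
move=> f0; have ex c : exists s : seq P,
    [/\ multichain s, size (rest s) = c & hodge_monomial s = theta (lev p) ^+ c].
  elim: c => [|c [s [hs sc es]]].
    exists [::]; have [u hu eu] := restP [::].
    have u0 : u = [::] by apply: perm_nilP; rewrite perm_sym.
    rewrite /hodge_monomial /hodge_prod eu u0 big_nil mulr1.
    by rewrite /std_monomial big_nil expr0.
  have [t [ht _ lt et]] := hodge_monomial_theta p hs; exists t; split=> //.
    by rewrite (perm_size lt) /= sc.
  by rewrite et es exprS.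
have [S hS] := choice ex.
have Sinj : injective S.
  by move=> c d e; have [_ <- _] := hS c; have [_ <- _] := hS d; rewrite e.
apply/eqP => e.
have := hodge_free (ms := map S (iota 0 (size f))) (c := fun s => f`_(size (rest s))).
rewrite map_inj_uniq // iota_uniq => /(_ isT) H.
have : all mchain (map S (iota 0 (size f))).
  by apply/allP => _ /mapP[c _ ->]; have [] := hS c.
move=> /H {}H.
suff /H{H}H : \sum_(s <- map S (iota 0 (size f))) f`_(size (rest s)) *: hodge_monomial s = 0.
  have sf : ((size f).-1 < size f)%N by rewrite ltn_predL size_poly_gt0.
  have := H (S (size f).-1); rewrite map_f ?mem_iota // => /(_ isT).
  have [_ -> _] := hS (size f).-1; rewrite -lead_coefE => /eqP.
  by rewrite lead_coef_eq0 (negPf f0).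
have fE : f = \sum_(i < size f) f`_i *: 'X^i by rewrite -[LHS]coefK poly_def.
rewrite big_map -[RHS]e [in RHS]fE /at_theta rmorph_sum.
rewrite -{1}[size f]subn0 -/(index_iota 0 (size f)) big_mkord; apply: eq_bigr => i _.
have [_ -> ->] := hS i.
by rewrite -mul_polyC rmorphM /= horner_algC mulr_algl rmorphXn /= horner_algX.
Qed.

End HodgeBasis.

(** * Ideals, primes and regular sequences *)

Section Ideals.

Variable R : comNzRingType.
Implicit Types (G : R -> Prop) (p q : {pred R}) (s : seq R).

Lemma ideal_gen0 G : ideal_gen G 0.
Proof. by exists [::]; rewrite big_nil. Qed.

Lemma ideal_genD G a b : ideal_gen G a -> ideal_gen G b -> ideal_gen G (a + b).
Proof.
move=> [s [hs ->]] [t [ht ->]]; exists (s ++ t); rewrite big_cat; split=> // cg.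
by rewrite mem_cat => /orP[/hs|/ht].
Qed.

Lemma ideal_genM G a b : ideal_gen G b -> ideal_gen G (a * b).
Proof.
move=> [s [hs ->]]; exists [seq (a * cg.1, cg.2) | cg <- s]; split.
  by move=> _ /mapP[cg /hs h ->].
by rewrite big_map mulr_sumr; apply: eq_bigr => cg _; rewrite mulrA.
Qed.

Lemma ideal_gen_base G g : G g -> ideal_gen G g.
Proof.
by move=> Gg; exists [:: (1, g)]; rewrite big_seq1 mul1r; split=> // cg;
  rewrite inE => /eqP->.
Qed.

Lemma ideal_gen_ind G (Q : R -> Prop) : Q 0 -> (forall a b, Q a -> Q b -> Q (a + b)) ->
  (forall a g, G g -> Q (a * g)) -> forall a, ideal_gen G a -> Q a.
Proof.
move=> Q0 QD QG a [s [hs ->]]; elim: s hs => [|cg s IHs] hs; rewrite ?big_nil //.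
rewrite big_cons; apply: QD; first by apply/QG/hs/mem_head.
by apply: IHs => d ds; apply: hs; rewrite inE ds orbT.
Qed.

Lemma ideal_gen_sub G G' a : (forall g, G g -> ideal_gen G' g) ->
  ideal_gen G a -> ideal_gen G' a.
Proof.
move=> h; apply: (ideal_gen_ind (Q := ideal_gen G')); [exact: ideal_gen0|exact: ideal_genD|].
by move=> b g /h; apply: ideal_genM.
Qed.

Lemma idealD p a b : idealr_closed p -> a \in p -> b \in p -> a + b \in p.
Proof. by move=> [_ _ h] ha hb; have := h 1 a b ha hb; rewrite mul1r. Qed.

Lemma idealM p a b : idealr_closed p -> b \in p -> a * b \in p.
Proof. by move=> [h0 _ h] hb; have := h a b 0 hb h0; rewrite addr0. Qed.

Lemma idealB p a b : idealr_closed p -> a \in p -> b \in p -> a - b \in p.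
Proof. by move=> hp ha hb; rewrite -mulN1r idealD // idealM. Qed.

Lemma ideal_gen_in p G a : idealr_closed p -> (forall g, G g -> g \in p) ->
  ideal_gen G a -> a \in p.
Proof.
move=> hp h; apply: (ideal_gen_ind (Q := fun x => x \in p)); first by have [] := hp.
- by move=> b c; apply: idealD.
- by move=> b g /h; apply: idealM.
Qed.

Lemma primeX p a k : prime_ideal p -> a \notin p -> a ^+ k \notin p.
Proof.
move=> [[_ p1 _] pm] ap; elim: k => [|k IHk]; first by rewrite expr0.
by rewrite exprS; apply: contra IHk => /pm; rewrite (negPf ap).
Qed.

(** Krull: an ideal maximal among those that contain [I] and avoid the
    multiplicative set [S] is prime. *)
Lemma exists_prime_avoiding (I : R -> Prop) (S : R -> Prop) :
  I 0 -> (forall a u v, I u -> I v -> I (a * u + v)) ->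
  S 1 -> (forall a b, S a -> S b -> S (a * b)) -> (forall a, S a -> ~ I a) ->
  exists q, [/\ prime_ideal q, forall a, I a -> a \in q & forall a, S a -> a \notin q].
Proof.
move=> I0 IC S1 SM SI.
pose good (J : R -> bool) := [/\ J 0, forall a u v, J u -> J v -> J (a * u + v),
  forall a, I a -> J a & forall a, S a -> ~~ J a].
have good0 : good (fun a => `[< I a >]).
  split=> [|a u v /asboolP hu /asboolP hv|a|a /SI n].
  - exact/asboolP.
  - by apply/asboolP/IC.
  - by move=> h; apply/asboolP.
  - exact/asboolPn.
pose le (J J' : {J : R -> bool | good J}) := `[< forall a, sval J a -> sval J' a >].
have [|||J' Jmax] := @classical_sets.ZL_preorder {J : R -> bool | good J} (exist _ _ good0) le.
- by move=> J; apply/asboolP.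
- by move=> J1 J2 J3 /asboolP h1 /asboolP h2; apply/asboolP => a /h1/h2.
- move=> A tot.
  have [[J1 AJ1]|nA] := pselect (exists J, A J); last first.
    by exists (exist _ _ good0) => J AJ; case: nA; exists J.
  have gU : good (fun a => `[< exists2 J, A J & sval J a >]).
    split.
    - by apply/asboolP; exists J1 => //; case: (svalP J1).
    - move=> a u v /asboolP[J2 AJ2 h2] /asboolP[J3 AJ3 h3]; apply/asboolP.
      have [/asboolP l|/asboolP l] := tot _ _ AJ2 AJ3.
        by exists J3 => //; case: (svalP J3) => _ h _ _; apply: h => //; apply: l.
      by exists J2 => //; case: (svalP J2) => _ h _ _; apply: h => //; apply: l.
    - by move=> a Ia; apply/asboolP; exists J1 => //; case: (svalP J1) => _ _ + _; apply.
    - move=> a Sa; apply/asboolPn => -[J2 AJ2].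
      by apply/negP; case: (svalP J2) => _ _ _; apply.
  by exists (exist _ _ gU) => J2 AJ2; apply/asboolP => a ha; apply/asboolP; exists J2.
have [J0 JC JI JS] := svalP J'.
set J := sval J' in J0 JC JI JS.
have J1 : ~~ J 1 by apply: JS.
have extend u : ~~ J u -> exists x a j, [/\ S x, J j & x = j + a * u].
  move=> Ju; pose Ju' x := `[< exists a j, J j /\ x = j + a * u >].
  have [//|ne] := pselect (exists x a j, [/\ S x, J j & x = j + a * u]).
  have gJ : good Ju'.
    split.
    - by apply/asboolP; exists 0, 0; rewrite mul0r addr0.
    - move=> a x y /asboolP[b [j [Jj ->]]] /asboolP[c [k [Jk ->]]]; apply/asboolP.
      by exists (a * b + c), (a * j + k); split; [exact: JC|ring].
    - by move=> a Ia; apply/asboolP; exists 0, a; rewrite mul0r addr0; split=> //; apply: JI.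
    - move=> a Sa; apply/asboolPn => -[b [j [Jj e]]]; apply: ne.
      by exists a, b, j.
  have /Jmax/asboolP h : le J' (exist _ _ gJ).
    by apply/asboolP => a /= Ja; apply/asboolP; exists 0, a; rewrite mul0r addr0.
  by case/negP: Ju; apply: h; apply/asboolP; exists 1, 0; rewrite add0r mul1r.
exists J; split=> //; split; first by split=> // a u v; apply: JC.
move=> u v Juv; apply/negPn/negP; rewrite negb_or => /andP[/extend + /extend].
move=> [s1 [a [j [S1' Jj e1]]]] [s2 [b [k [S2 Jk e2]]]].
have := JS _ (SM _ _ S1' S2); apply/negP/negPn.
have -> : s1 * s2 = (k + b * v) * j + (a * u * k + (a * b * (u * v) + 0)).
  by rewrite e1 e2; ring.
apply: (JC _ _ _ Jj); rewrite -mulrA; apply: (JC); last exact: JC.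
by have := JC u _ _ Jk J0; rewrite addr0.
Qed.

(** Descend from [p]. Given a prime [q] containing the first [i + 1] terms, the
    products [s_i ^ k * t] with [t] outside [q] avoid the ideal of the first
    [i] terms, because [s_i] is regular modulo that ideal. A prime avoiding
    these products is contained in [q] and does not contain [s_i]. *)
Lemma regular_prime_chain s p : regular_sequence s -> prime_ideal p ->
  {subset s <= p} -> prime_chain R (size s).
Proof.
move=> [reg _] pp sp; set d := size s.
suff [P [hP1 hP2]] : exists P : nat -> {pred R},
    (forall k, (d - d <= k <= d)%N -> prime_ideal (P k) /\ {subset take k s <= P k}) /\
    (forall k, (d - d <= k < d)%N -> {subset P k <= P k.+1} /\ ~ {subset P k.+1 <= P k}).
  exists P; split=> [i hi|i hi]; first by have [] := hP1 i; rewrite ?subnn.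
  by apply: hP2; rewrite subnn.
have : (d <= d)%N by []. move: {1 4 7}d => j.
elim: j => [|j IHj] hj.
  exists (fun=> p); split=> [k hk|k]; last by rewrite subn0; lia.
  by split=> // a /mem_take; apply: sp.
have [|P [h1 h2]] := IHj; first lia.
pose i := (d - j.+1)%N; have iE : (d - j)%N = i.+1 by rewrite /i; lia.
have [[pP pm] sP] : prime_ideal (P i.+1) /\ {subset take i.+1 s <= P i.+1}.
  by apply: h1; rewrite -iE; lia.
have si : (i < size s)%N by rewrite -/d /i; lia.
pose S a := exists k t, t \notin P i.+1 /\ a = s`_i ^+ k * t.
have [||||a|q [qp qI qS]] := @exists_prime_avoiding (ideal_gen (fun g => g \in take i s)) S.
- exact: ideal_gen0.
- by move=> a u v hu hv; apply: ideal_genD => //; apply: ideal_genM.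
- by exists 0%N, 1; rewrite expr0 mulr1; split=> //; case: pP.
- move=> a b [k [t [ht ->]]] [l [u [hu ->]]]; exists (k + l)%N, (t * u).
  split; last by rewrite exprD; ring.
  by apply/negP => /pm; rewrite (negPf ht) (negPf hu).
- move=> [k [t [ht ->]]]; elim: k => [|k IHk].
    rewrite expr0 mul1r => /(ideal_gen_in pP) h; case/negP: ht; apply: h => g.
    by move=> gt; apply: sP; rewrite (take_nth 0 si) mem_rcons inE gt orbT.
  by rewrite exprS -mulrA => /(reg _ si).
have qP : {subset q <= P i.+1}.
  move=> a aq; apply/negPn/negP => aP.
  have := qS a; rewrite aq => h; suff : S a by move/h.
  by exists 0%N, a; rewrite expr0 mul1r.
have sq : s`_i \notin q.
  by apply: qS; exists 1%N, 1; rewrite mulr1 expr1; split=> //; case: pP.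
exists (fun k => if k == i then q else P k); split=> k hk.
  have [ki|ki] := eqVneq k i; last by apply: h1; lia.
  by split=> // a; rewrite ki => ai; apply/qI/ideal_gen_base.
have [ki|ki] := eqVneq k i.
  rewrite ki; have -> : (i.+1 == i) = false by lia.
  split=> // /(_ s`_i); rewrite (negPf sq) => h; suff : false by [].
  by apply: h; apply: sP; rewrite (take_nth 0 si) mem_rcons mem_head.
have -> : (k.+1 == i) = false by rewrite /i; lia.
by apply: h2; lia.
Qed.

End Ideals.

(** The operator [rho i] kills the ideal of [s_i], is the identity modulo that
    ideal and commutes with the other terms. The composite of the first [i] of
    them thus decides membership in the ideal of the first [i] terms and
    commutes with [s_i], which is not a zero divisor in the domain [R]. *)
Lemma regular_of_remainders (R : comNzRingType) (s : seq R) (rho : nat -> R -> R) :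
  (forall a b : R, a * b = 0 -> a = 0 \/ b = 0) ->
  (forall i, (i < size s)%N -> s`_i != 0) ->
  (forall i x y, (i < size s)%N -> rho i (x + y) = rho i x + rho i y) ->
  (forall i k x, (i < size s)%N -> (k < size s)%N -> i != k ->
     rho i (s`_k * x) = s`_k * rho i x) ->
  (forall i x, (i < size s)%N -> rho i (s`_i * x) = 0) ->
  (forall i x, (i < size s)%N -> exists y, x - rho i x = s`_i * y) ->
  forall i, (i < size s)%N -> forall a,
    ideal_gen (fun g => g \in take i s) (s`_i * a) ->
    ideal_gen (fun g => g \in take i s) a.
Proof.
move=> dom s0 rD rC rK rR.
(* [C i] applies [rho (i - 1)] first and [rho 0] last. *)
pose C := fix C i x := if i is j.+1 then C j (rho j x) else x : R.
have CD i : (i <= size s)%N -> forall x y, C i (x + y) = C i x + C i y.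
  by elim: i => //= i IHi hi x y; rewrite rD // IHi // ltnW.
have r0 i : (i < size s)%N -> rho i 0 = 0.
  by move=> hi; have := rK i 0 hi; rewrite mulr0.
have C0 i : (i <= size s)%N -> C i 0 = 0.
  by elim: i => //= i IHi hi; rewrite r0 // IHi // ltnW.
have CC i k x : (i <= k)%N -> (k < size s)%N -> C i (s`_k * x) = s`_k * C i x.
  elim: i x => //= i IHi x ik ks; rewrite rC //; last by rewrite neq_ltn ik.
    by rewrite IHi // ltnW.
  exact: ltn_trans ks.
have CK i k x : (i <= size s)%N -> (k < i)%N -> C i (s`_k * x) = 0.
  elim: i x => //= i IHi x hi; rewrite ltnS leq_eqVlt => /orP[/eqP->|ki].
    by rewrite rK // C0 // ltnW.
  rewrite rC ?IHi //; first exact: ltnW.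
    by apply: ltn_trans hi.
  by rewrite gtn_eqF.
have CR i x : (i <= size s)%N -> ideal_gen (fun g => g \in take i s) (x - C i x).
  elim: i x => [|i IHi] x hi /=; first by rewrite subrr; apply: ideal_gen0.
  have [y hy] := rR i x hi.
  rewrite -(subrKA (rho i x)) hy mulrC; apply: ideal_genD.
    by apply/ideal_genM/ideal_gen_base; rewrite (take_nth 0 hi) mem_rcons mem_head.
  apply: ideal_gen_sub (IHi _ (ltnW hi)) => g gi; apply: ideal_gen_base.
  by rewrite (take_nth 0 hi) mem_rcons inE gi orbT.
move=> i hi a ha; have hi' := ltnW hi.
have : C i (s`_i * a) = 0.
  apply: (ideal_gen_ind (Q := fun x => C i x = 0)) ha; first exact: C0.
    by move=> x y hx hy; rewrite CD // hx hy addr0.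
  move=> b g gi; have [k ki <-] : exists2 k, (k < i)%N & s`_k = g.
    have := gi; rewrite -index_mem size_take hi => ki.
    exists (index g (take i s)) => //.
    by rewrite -(nth_take 0 ki) nth_index.
  by rewrite mulrC CK.
rewrite CC // => /dom[e|e]; first by have := s0 _ hi; rewrite e eqxx.
by have := CR i a hi'; rewrite e subr0.
Qed.

(** * Dimension of filtered algebras *)

Section ChainBound.

Variables (K : fieldType) (R : comAlgType K).

(** The monomial in [rs] with exponent vector [a]. *)
Fixpoint power_prod (rs : seq R) (a : seq nat) : R :=
  if rs is r :: rs' then r ^+ head 0%N a * power_prod rs' (behead a) else 1.

(** Elements [r_i] of [p (i + 1)] outside [p i] are algebraically independent
    modulo [p 0]. Divide a relation by the highest power of the first element
    that it allows; as that element is outside the prime [p 0], the quotient is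
    still in [p 0]. Modulo [p 1] the first element vanishes and a nontrivial
    relation between the others is left. *)
Lemma prime_chain_independent (rs : seq R) (p : nat -> {pred R}) :
  (forall i, (i <= size rs)%N -> prime_ideal (p i)) ->
  (forall i, (i < size rs)%N ->
    [/\ {subset p i <= p i.+1}, rs`_i \in p i.+1 & rs`_i \notin p i]) ->
  forall (A : seq (seq nat)) (c : seq nat -> K), uniq A ->
    all (fun a => size a == size rs) A -> A != [::] ->
    {in A, forall a, c a != 0} ->
    \sum_(a <- A) c a *: power_prod rs a \notin p 0%N.
Proof.
elim: rs p => [|r rs IHrs] p pP hp A c uA /allP sA A0 cA.
  have e : A = [:: [::]].
    case: A uA sA A0 {cA} => // a [|b A] /= uA sA _.
      by have := sA a (mem_head _ _); case: a {uA sA}.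
    have := sA a (mem_head _ _); have := sA b; rewrite !inE eqxx orbT => /(_ isT).
    by case: a b uA {sA} => [|? ?] [|? ?].
  have ca : c [::] != 0 by apply: cA; rewrite e mem_head.
  have [hp0 _] := pP 0%N isT.
  rewrite e big_seq1 /=; apply/negP => /(idealM (c [::])^-1%:A hp0).
  by rewrite mulr_algl scalerA mulVf // scale1r; case: hp0 => _ /negP.
have [k [a0 a0A [a0k km]]] : exists k, exists2 a0, a0 \in A & head 0%N a0 = k /\
    {in A, forall a, (k <= head 0 a)%N}.
  have ex : exists k, has (fun a => head 0%N a == k) A.
    case: A A0 {uA sA cA} => // a A _; by exists (head 0%N a); rewrite /= eqxx.
  case: (ex_minnP ex) => k /hasP[a aA /eqP ak] km; exists k; exists a => //.
  by split=> // b bA; apply: km; apply/hasP; exists b.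
pose q i := p i.+1.
have [pS rp1 rp0] := hp 0%N isT.
pose A1 := [seq a <- A | head 0%N a == k].
have consA1 a : a \in A1 -> a = k :: behead a.
  rewrite mem_filter => /andP[/eqP <- /sA]; by case: a.
have := IHrs q (fun i hi => pP i.+1 hi) (fun i hi => hp i.+1 hi) (map behead A1)
  (fun a => c (k :: a)).
have -> : \sum_(a <- map behead A1) c (k :: a) *: power_prod rs a =
    \sum_(a <- A1) c a *: power_prod rs (behead a).
  by rewrite big_map big_seq [RHS]big_seq; apply: eq_bigr => a aA1; rewrite -(consA1 a aA1).
move=> H; apply/negP => hin.
have {}H : \sum_(a <- A1) c a *: power_prod rs (behead a) \notin p 1%N.
  apply: H.
  - rewrite map_inj_in_uniq ?filter_uniq // => a b /consA1 {2}-> /consA1 {2}->.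
    by move=> ->.
  - by apply/allP => _ /mapP[a + ->]; rewrite mem_filter => /andP[_ /sA]; case: a.
  - apply/negP => /eqP e; have : a0 \in A1 by rewrite mem_filter a0k eqxx.
    by move=> /(map_f behead); rewrite e.
  - move=> _ /mapP[a aA1 ->]; rewrite -(consA1 _ aA1); apply: cA.
    by move: aA1; rewrite mem_filter => /andP[].
(* What the terms with larger exponent contribute after division by [r ^ (k + 1)]. *)
pose rem := \sum_(a <- A | head 0%N a != k)
   c a *: (r ^+ (head 0%N a - k).-1 * power_prod rs (behead a)).
have E : \sum_(a <- A) c a *: power_prod (r :: rs) a =
    r ^+ k * (\sum_(a <- A1) c a *: power_prod rs (behead a) + rem * r).
  rewrite (bigID (fun a => head 0%N a == k)) /= mulrDr big_filter; congr (_ + _).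
    by rewrite mulr_sumr; apply: eq_bigr => a /eqP->; rewrite scalerAr.
  rewrite /rem mulr_suml mulr_sumr big_seq_cond [RHS]big_seq_cond.
  apply: eq_bigr => a /andP[/km ka nk].
  rewrite -scalerAl -scalerAr; congr (_ *: _).
  rewrite mulrAC -exprSr prednK; last by rewrite subn_gt0 ltn_neqAle eq_sym nk.
  by rewrite mulrA -exprD subnKC.
have [[hp0 pm] [hp1 _]] := (pP 0%N isT, pP 1%N isT).
move: hin; rewrite E => /pm; rewrite (negPf (primeX _ (pP 0%N isT) rp0)) /=.
move=> /pS /idealB - /(_ _ hp1 (idealM rem hp1 rp1)).
by rewrite addrK; apply/negP.
Qed.

Variables (I : choiceType) (B : I -> R) (Q : pred I) (deg : I -> nat).

Definition filtered (M : nat) (x : R) := spans B [pred i | Q i && (deg i <= M)%N] x.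

Hypothesis span1 : filtered 0 1.
Hypothesis spanM : forall i j, Q i -> Q j -> filtered (deg i + deg j) (B i * B j).
Hypothesis spanT : forall x, spans B Q x.

Lemma filtered_le M N x : (M <= N)%N -> filtered M x -> filtered N x.
Proof.
move=> MN; apply: spans_sub => i; rewrite !inE => /andP[-> h] /=.
exact: leq_trans MN.
Qed.

Lemma filteredM M N x y : filtered M x -> filtered N y -> filtered (M + N) (x * y).
Proof.
move=> [l /allP hl ->] [k /allP hk ->]; rewrite mulr_suml; apply: spans_sum => ci /hl.
move=> /andP[Qi di]; rewrite mulr_sumr; apply: spans_sum => cj /hk /andP[Qj dj].
rewrite -scalerAl -scalerAr; do 2!apply: spansZ.
by apply: filtered_le (spanM Qi Qj); apply: leq_add.
Qed.

Lemma filtered_exists x : exists M, filtered M x.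
Proof.
have [l /allP hl ->] := spanT x.
exists (\sum_(ci <- l) deg ci.2)%N; apply: spans_sum => ci cl; apply: spansZ.
apply: spans_base; rewrite inE hl //= (perm_big _ (perm_to_rem cl)) big_cons.
exact: leq_addr.
Qed.

Lemma filteredX M x k : filtered M x -> filtered (k * M) (x ^+ k).
Proof.
move=> hx; elim: k => [|k IHk]; first exact: span1.
by rewrite exprS mulSn; apply: filteredM.
Qed.

(** If the pieces of the filtration grow like [M ^ d], there is no room for
    more than [d] algebraically independent elements, so
    [prime_chain_independent] bounds chains of primes. *)
Lemma prime_chain_bound (C d : nat) :
  (forall M, exists (T : finType) (tau : I -> T),
     {in [pred i | Q i && (deg i <= M)%N] &, injective tau} /\
     (#|T| <= C * M.+1 ^ d)%N) ->
  forall e, prime_chain R e -> (e <= d)%N.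
Proof.
move=> count e [p [pP pS]]; rewrite leqNgt; apply/negP => de.
have rex i : exists r : R, (i < e)%N -> r \in p i.+1 /\ r \notin p i.
  have [ie|//] := boolP (i < e)%N; last by exists 0.
  apply: contrapT => h; have [_] := pS i ie; case=> x xi.
  by apply/negPn/negP => xn; apply: h; exists x.
have [r hr] := choice rex.
have [D hD] : exists D, forall i, (i < e)%N -> filtered D (r i).
  elim: (e) => [|m [D IHD]]; first by exists 0%N.
  have [M hM] := filtered_exists (r m); exists (D + M)%N => i.
  rewrite ltnS leq_eqVlt => /orP[/eqP->|/IHD].
    by apply: filtered_le hM; apply: leq_addl.
  by apply: filtered_le; apply: leq_addr.
pose rs := mkseq r e; have srs : size rs = e by rewrite size_mkseq.
have F (N : nat) rs' a : {in rs', forall x, filtered D x} -> size a = size rs' ->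
    all (fun k => k <= N)%N a -> filtered (size rs' * (N * D)) (power_prod rs' a).
  elim: rs' a => [|x rs' IH] [|k a] //= h [sa] /andP[kN aN].
  rewrite mulSn; apply: filteredM.
    apply: filtered_le (filteredX _ (h x (mem_head _ _))).
    by rewrite leq_mul2r kN orbT.
  by apply: IH => // y ys; apply: h; rewrite inE ys orbT.
(* There are [(N + 1) ^ e] monomials with exponents at most [N], in a space of dimension
   at most [C (M + 1) ^ d]; as [M + 1 <= (e D + 1) (N + 1)], this choice of [N] makes the
   former larger when [d < e]. *)
pose N := (C * (e * D).+1 ^ d).+1; pose M := (e * (N * D))%N.
have [T [tau [tinj cT]]] := count M.
pose exps (f : {ffun 'I_e -> 'I_N.+1}) : seq nat := [seq (f i : nat) | i <- enum 'I_e].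
have sexps f : size (exps f) = e by rewrite size_map size_enum_ord.
have expsK f (i : 'I_e) : nth 0%N (exps f) i = f i.
  by rewrite (nth_map i) ?size_enum_ord // nth_ord_enum.
have expsI : injective exps.
  by move=> f g e'; apply/ffunP => i; apply/val_inj; rewrite /= -!expsK e'.
have fv f : filtered M (power_prod rs (exps f)).
  rewrite /M -srs; apply: F; rewrite ?sexps ?srs //.
    by move=> x /mapP[i]; rewrite mem_iota => ie ->; apply: hD.
  by apply/allP => _ /mapP[i _ ->]; rewrite -ltnS.
have [|c [f0 cf0] c0] := dependent_count tinj fv.
  apply: (leq_ltn_trans cT); rewrite card_ffun !card_ord.
  apply: (@leq_ltn_trans (N * N.+1 ^ d)).
    apply: (@leq_trans (C * ((e * D).+1 ^ d * N.+1 ^ d))).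
      have leX a b : (a <= b)%N -> (a ^ d <= b ^ d)%N.
        by move=> ab; elim: (d) => // k IHk; rewrite !expnS leq_mul.
      by rewrite leq_mul2l -expnMn leX ?orbT // /M; nia.
    by rewrite mulnA leq_mul2r leqnSn orbT.
  apply: (@leq_trans (N.+1 ^ d.+1)); first by rewrite expnS ltn_mul2r expn_gt0 ltnSn.
  by rewrite leq_exp2l.
pose A := [seq exps f | f <- enum {ffun 'I_e -> 'I_N.+1} & c f != 0].
pose c' (a : seq nat) := c [ffun i : 'I_e => inord (nth 0%N a i)].
have c'E f : c' (exps f) = c f.
  by congr c; apply/ffunP => i; rewrite ffunE expsK inord_val.
have z : \sum_(a <- A) c' a *: power_prod rs a = 0.
  rewrite big_map big_filter big_enum_cond /=.
  rewrite -[RHS]c0 [RHS](bigID (fun f => c f != 0)) /= [X in _ + X]big1 ?addr0.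
    by apply: eq_big => [f|f _]; rewrite ?c'E ?andbT.
  by move=> f /negPn/eqP->; rewrite scale0r.
suff : \sum_(a <- A) c' a *: power_prod rs a \notin p 0%N.
  by rewrite z; have [[->]] := pP 0%N isT.
apply: prime_chain_independent.
- by move=> i; rewrite srs; apply: pP.
- move=> i; rewrite srs => ie; rewrite nth_mkseq //; have [h1 h2] := hr i ie.
  by have [h3 _] := pS i ie.
- by rewrite map_inj_uniq // filter_uniq // enum_uniq.
- by apply/allP => _ /mapP[f _ ->]; rewrite sexps srs.
- apply/negP => /eqP eA; have : exps f0 \in A.
    by apply: map_f; rewrite mem_filter cf0 mem_enum.
  by rewrite eA.
- by move=> _ /mapP[f + ->]; rewrite mem_filter c'E => /andP[].
Qed.

End ChainBound.

(** * Noetherian rings *)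

Section Dickson.

(** Choose each term minimal among all later terms. *)
Lemma monotone_subsequence (h : nat -> nat) : exists g : nat -> nat,
  (forall i, g i < g i.+1)%N /\ {homo (h \o g) : i j / (i <= j)%N}.
Proof.
have next N : exists i, (N <= i)%N /\ forall j, (N <= j)%N -> (h i <= h j)%N.
  have ex : exists v, `[< exists2 i, (N <= i)%N & h i = v >].
    by exists (h N); apply/asboolP; exists N.
  case: (ex_minnP ex) => v /asboolP[i Ni <-] vm; exists i; split=> // j Nj.
  by apply: vm; apply/asboolP; exists j.
have [nx hnx] := choice next.
pose g := fix g i := if i is j.+1 then nx (g j).+1 else nx 0%N.
have gS i : (g i < g i.+1)%N by have [] := hnx (g i).+1.
exists g; split=> //; apply: homo_leq => [x||i] //=; first exact: leq_trans.
case: i => [|i] /=; first by have [_] := hnx 0%N; apply.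
have [h1 h2] := hnx (g i).+1; have [h3 _] := hnx (nx (g i).+1).+1.
by apply: h2; apply: leq_trans h1 (ltnW h3).
Qed.

Lemma dickson_pair k (f : nat -> 'X_{1..k}) : exists i j, (i < j)%N /\ (f i <= f j)%MM.
Proof.
suff [g [gS gm]] : exists g : nat -> nat, (forall i, g i < g i.+1)%N /\
    {in enum 'I_k, forall c, {homo (fun i => f (g i) c) : i j / (i <= j)%N}}.
  exists (g 0%N), (g 1%N); split=> //; apply/mnm_lepP => c.
  by apply: (gm c); rewrite ?mem_enum.
elim: (enum 'I_k) => [|c s [g [gS gm]]]; first by exists id.
have [g' [gS' gm']] := monotone_subsequence (fun i => f (g i) c).
have gM : {homo g : i j / (i < j)%N} by apply: homo_ltn => //; exact: ltn_trans.
have gL : {homo g' : i j / (i <= j)%N}.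
  by apply: homo_leq => [x||i] //; [exact: leq_trans|exact: ltnW].
exists (g \o g'); split=> [i|d] /=; first exact: gM.
rewrite inE => /orP[/eqP-> i j /gm' //|/gm hd i j /gL]; exact: hd.
Qed.

(** Otherwise one could choose a sequence of exponents none of which is
    divisible by an earlier one, against [dickson_pair]. *)
Lemma dickson k (A : pred 'X_{1..k}) : exists s : seq 'X_{1..k},
  all A s /\ forall m, A m -> exists2 m', m' \in s & (m' <= m)%MM.
Proof.
apply: contrapT => nb.
have F' (s : seq 'X_{1..k}) : exists m, all A s ->
    A m /\ forall m', m' \in s -> ~~ (m' <= m)%MM.
  have [As|//] := boolP (all A s); last by exists 0%MM.
  apply: contrapT => nm; apply: nb; exists s; split=> // m Am.
  apply: contrapT => n; apply: nm; exists m => _; split=> // m' ms.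
  by apply/negP => le; apply: n; exists m'.
have [F hF] := choice F'.
(* The list of the exponents chosen so far. *)
pose hist := fix hist n := if n is n'.+1 then F (hist n') :: hist n' else [::].
have hA n : all A (hist n).
  by elim: n => //= n IHn; rewrite IHn andbT; have [] := hF _ IHn.
have [i [j [ij le]]] := dickson_pair (fun n => F (hist n)).
have [_ /(_ (F (hist i)))] := hF _ (hA j).
rewrite le => H; suff : false by []. apply: H.
elim: j ij {le} => // j IHj; rewrite ltnS leq_eqVlt inE => /orP[/eqP->|/IHj->].
  by rewrite eqxx.
by rewrite orbT.
Qed.

End Dickson.

(** Hilbert's basis theorem: by Dickson's lemma finitely many members of the
    ideal have leading monomials dividing all others, and division by them
    terminates. *)
Lemma noetherian_mpoly (K : fieldType) k : noetherian_ring {mpoly K[k]}.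
Proof.
move=> I hI.
have [s [/allP sA sB]] :=
  dickson (fun m => `[< exists p, [/\ p \in I, p != 0 & mlead p = m] >]).
have g' m : exists p : {mpoly K[k]}, m \in s -> [/\ p \in I, p != 0 & mlead p = m].
  have [ms|] := boolP (m \in s); last by exists 0.
  by have /asboolP[p hp] := sA m ms; exists p.
have [g hg] := choice g'.
exists (map g s) => p; split; last first.
  by apply: ideal_gen_in => // _ /mapP[m /hg[+ _ _] ->].
elim/mleadrect: p => p IHp pI.
have [->|p0] := eqVneq p 0; first exact: ideal_gen0.
have [|m ms le] := sB (mlead p); first by apply/asboolP; exists p.
have [gI g0 gm] := hg m ms.
pose q := (mleadc p / mleadc (g m)) *: 'X_[mlead p - m] * g m.
have c0 : mleadc p / mleadc (g m) != 0.
  by rewrite mulf_neq0 ?invr_eq0 ?mleadc_eq0.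
have X0 : (mleadc p / mleadc (g m)) *: 'X_[mlead p - m] != 0 :> {mpoly K[k]}.
  by rewrite -mleadc_eq0 mleadcZE mleadXm mcoeffX eqxx mulr1.
have mq : mlead q = mlead p.
  by rewrite mleadM // mleadZ // mleadXm gm submK.
have cq : mleadc q = mleadc p.
  by rewrite mleadcM_proper ?mulf_neq0 ?mleadc_eq0 // mleadcZE mleadXm mcoeffX eqxx
     mulr1 divfK // mleadc_eq0.
have hq : ideal_gen (fun h => h \in map g s) q.
  exact/ideal_genM/ideal_gen_base/map_f.
rewrite -[p](subrK q); apply: ideal_genD => //.
have [->|pq0] := eqVneq (p - q) 0; first exact: ideal_gen0.
apply: IHp; last by rewrite idealB // idealM.
have : (mlead (p - q) <= mlead p)%O.
  by apply: le_trans (mleadB_le _ _) _; rewrite mq joinxx.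
rewrite le_eqVlt => /orP[/eqP e|//].
have := mleadc_eq0 (p - q); rewrite e mcoeffB -{2}mq cq subrr eqxx.
by rewrite (negPf pq0).
Qed.

Lemma noetherian_surj (R S : comNzRingType) (f : {rmorphism R -> S}) :
  (forall y, exists x, y = f x) -> noetherian_ring R -> noetherian_ring S.
Proof.
move=> fs noeth I hI; have [I0 I1 IC] := hI.
have [|s hs] := noeth [pred a | f a \in I].
  split=> [||a u v]; rewrite !inE ?rmorph0 ?rmorph1 //.
  by rewrite rmorphD rmorphM; apply: IC.
exists (map f s) => y; split; last first.
  apply: ideal_gen_in => // _ /mapP[a sa ->].
  by have : a \in [pred a | f a \in I]; [apply/hs/ideal_gen_base|rewrite inE].
have [a ->] := fs y => aI; have /hs : a \in [pred a | f a \in I] by [].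
apply: (ideal_gen_ind (Q := fun b => ideal_gen (fun g => g \in map f s) (f b))).
- by rewrite rmorph0; apply: ideal_gen0.
- by move=> b c hb hc; rewrite rmorphD; apply: ideal_genD.
- by move=> b g gs; rewrite rmorphM; apply/ideal_genM/ideal_gen_base/map_f.
Qed.

(** * The Nullstellensatz *)

(** The field is [Q] itself; the morphism into it comes with a bijection back
    to [Q] so that facts about [pi] can be transported. *)
Lemma field_of_inverses (R Q : comNzRingType) (pi : {rmorphism R -> Q}) (inv : Q -> Q) :
  (forall x, x != 0 -> inv x * x = 1) -> inv 0 = 0 ->
  exists (F : fieldType) (pi' : {rmorphism R -> F}) (f : F -> Q),
    bijective f /\ f \o pi' =1 pi.
Proof.
move=> invM inv0.
pose F : fieldType := HB.pack (GRing.ComNzRing.sort Q)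
  (GRing.ComNzRing_isField.Build Q invM inv0).
exists F, pi, idfun; split=> //; by exists idfun.
Qed.

Lemma exists_residue_field (R : comNzRingType) (m : prime_idealr R) :
  maximal_ideal (m : {pred R}) -> exists (F : fieldType) (pi : {rmorphism R -> F}),
    (forall x, exists a, x = pi a) /\ forall a, (pi a == 0) = (a \in (m : {pred R})).
Proof.
move=> [hm mm].
pose Q : comNzRingType := {ideal_quot (m : idealr R)}.
pose pi : {rmorphism R -> Q} := \pi_({ideal_quot (m : idealr R)})%qT.
have pi0 a : (pi a == 0) = (a \in (m : {pred R})).
  by rewrite -[a in RHS]subr0 Quotient.idealrBE -[0 in LHS](rmorph0 pi).
have pis (x : Q) : exists a, x = pi a by exists (repr x); rewrite /= reprK.
have inv' (x : Q) : exists y : Q, (x != 0 -> y * x = 1) /\ (x = 0 -> y = 0).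
  have [->|x0] := eqVneq x 0; first by exists 0.
  have [a ea] := pis x; have am : a \notin (m : {pred R}) by rewrite -pi0 -ea.
  (* The ideal generated by [m] and [a]. *)
  pose J : {pred R} := [pred b | `[< exists c j, j \in (m : {pred R}) /\ b = c * a + j >]].
  have [J1|nJ1] := boolP (1 \in J).
    have /asboolP[c [j [jm e]]] := J1; exists (pi c); split=> [_|/eqP]; last by rewrite (negPf x0).
    have : pi 1 = pi (c * a + j) by rewrite -e.
    rewrite rmorphD rmorphM rmorph1 -ea => ->.
    have /eqP -> : pi j == 0 by rewrite pi0.
    by rewrite addr0.
  case/negP: am; apply: (mm J) => [|j jm|].
  - split=> //; first by apply/asboolP; exists 0, 0; rewrite idealr0 mul0r addr0.
    move=> b u v /asboolP[c [j [jm ->]]] /asboolP[d [k [km ->]]]; apply/asboolP.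
    exists (b * c + d), (b * j + k); split; last by ring.
    by case: hm => _ _; apply.
  - by apply/asboolP; exists 0, j; rewrite mul0r add0r.
  - by apply/asboolP; exists 1, 0; rewrite mul1r addr0 idealr0.
have [inv hinv] := choice inv'.
have invM (x : Q) : x != 0 -> inv x * x = 1 by have [] := hinv x.
have inv0 : inv 0 = 0 by have [_ ->] := hinv 0.
have [F [pi' [f [[g fK gK] fpi]]]] := field_of_inverses pi invM inv0.
have fi := can_inj fK.
exists F, pi'; split=> [x|a].
  by have [a ea] := pis (f x); exists a; apply: fi; rewrite ea -fpi.
rewrite -pi0 -!fpi /= -[0 in LHS](rmorph0 pi') -[0 in RHS](rmorph0 pi) -fpi.
by rewrite (inj_eq fi).
Qed.

Section ZariskiLemma.

Variable F : fieldType.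

Definition ring_generated (A : pzRingType) (iota : A -> F) (c : seq F) : Prop :=
  forall S : F -> Prop, (forall a, S (iota a)) -> {in c, forall x, S x} ->
    (forall x y, S x -> S y -> S (x + y)) -> (forall x y, S x -> S y -> S (x * y)) ->
    forall x, S x.

Definition algebraic_over (A : idomainType) (iota : A -> F) (x : F) : Prop :=
  exists2 p : {poly A}, p != 0 & root (map_poly iota p) x.

(** Inverting the single element [a] makes [A] a field. *)
Definition divides_powers (A : idomainType) : Prop :=
  exists2 a : A, a != 0 & forall x : A, x != 0 -> exists N y, x * y = a ^+ N.

(** Multiplying an algebraic element by the leading coefficient of its equation
    makes it integral. *)
Lemma integral_multiple (A : idomainType) (iota : {rmorphism A -> F}) x :
  injective iota -> algebraic_over iota x ->
  exists2 a : A, a != 0 & integralOver iota (iota a * x).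
Proof.
move=> inj [p p0 rp]; pose a := lead_coef p.
have smap := size_map_inj_poly inj (rmorph0 iota).
have [n pn] : exists n, size p = n.+2.
  have : (1 < size (map_poly iota p))%N.
    by apply: root_size_gt1 rp; rewrite -size_poly_eq0 smap size_poly_eq0.
  by rewrite smap; case: (size p) => [|[|n]] // _; exists n.
have an : p`_n.+1 = a by rewrite /a lead_coefE pn.
exists a; first by rewrite lead_coef_eq0.
(* The equation of [x] times [a ^ n], rewritten in terms of [a * x]. *)
exists (\poly_(i < n.+2) (if i == n.+1 then 1 else p`_i * a ^+ (n - i))).
  by rewrite monicE lead_coef_poly // eqxx // oner_neq0.
apply/rootP; rewrite (@horner_coef_wide _ n.+2); last first.
  by rewrite (leq_trans (size_poly _ _)) // size_poly.
transitivity (iota a ^+ n * (map_poly iota p).[x]); last first.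
  by rewrite (rootP rp) mulr0.
rewrite (@horner_coef_wide _ n.+2 (map_poly iota p)); last first.
  by rewrite (leq_trans (size_poly _ _)) // pn.
rewrite mulr_sumr; apply: eq_bigr => i _; rewrite !coef_map coef_poly ltn_ord /=.
have [->|ni] := eqVneq (i : nat) n.+1.
  by rewrite rmorph1 an exprMn exprS; ring.
have ile : (i <= n)%N by have := ltn_ord i; rewrite ltnS leq_eqVlt (negPf ni).
have -> : iota a ^+ n = iota a ^+ (n - i) * iota a ^+ i by rewrite -exprD subnK.
by rewrite rmorphM rmorphXn exprMn; ring.
Qed.

Lemma integral_multiples (A : idomainType) (iota : {rmorphism A -> F}) (c : seq F) :
  injective iota -> {in c, forall x, algebraic_over iota x} ->
  exists2 a : A, a != 0 & {in c, forall x, integralOver iota (iota a * x)}.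
Proof.
move=> inj; elim: c => [|x c IHc] hc; first by exists 1; rewrite ?oner_neq0.
have [|a a0 ha] := IHc; first by move=> y yc; apply: hc; rewrite inE yc orbT.
have [b b0 hb] := integral_multiple inj (hc x (mem_head _ _)).
exists (a * b); first by rewrite mulf_neq0.
move=> y; rewrite inE rmorphM => /orP[/eqP->|/ha hy].
  by rewrite -mulrA; apply: integral_mul => //; apply: integral_id.
by rewrite [iota a * _]mulrC -mulrA; apply: integral_mul => //; apply: integral_id.
Qed.

(** If [F] is generated over [A] by algebraic elements, then a power of one [a]
    makes any element of [F] integral. For [y = 1 / x] clearing denominators in
    the integral equation of [a ^ N * y] shows that [x] divides a power of [a].
    *)
Lemma algebraic_divides_powers (A : idomainType) (iota : {rmorphism A -> F}) c :
  injective iota -> {in c, forall x, algebraic_over iota x} ->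
  ring_generated iota c -> divides_powers A.
Proof.
move=> inj /(integral_multiples inj)[a a0 ha] gen; exists a => // x x0.
have [N [q mq rq]] : exists N, integralOver iota (iota a ^+ N * (iota x)^-1).
  apply: (gen (fun y => exists N, integralOver iota (iota a ^+ N * y))).
  - by move=> b; exists 0%N; rewrite expr0 mul1r; apply: integral_id.
  - by move=> y /ha; exists 1%N; rewrite expr1.
  - move=> y z [M hy] [N hz]; exists (M + N)%N; rewrite mulrDr exprD.
    apply: integral_add; last by rewrite -mulrA; apply: integral_mul => //;
      rewrite -rmorphXn; apply: integral_id.
    by rewrite mulrAC; apply: integral_mul => //; rewrite -rmorphXn; apply: integral_id.
  - move=> y z [M hy] [N hz]; exists (M + N)%N; rewrite exprD mulrACA.
    exact: integral_mul.
have smap := size_map_inj_poly inj (rmorph0 iota).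
have ix0 : iota x != 0 by rewrite -(rmorph0 iota) (inj_eq inj).
have [n qn] : exists n, size q = n.+2.
  have : (1 < size (map_poly iota q))%N.
    by apply: root_size_gt1 rq; rewrite -size_poly_eq0 smap size_poly_eq0 monic_neq0.
  by rewrite smap; case: (size q) => [|[|n]] // _; exists n.
have q1 : q`_n.+1 = 1 by have := monicP mq; rewrite lead_coefE qn.
(* Multiply the equation of degree [n + 1] by [x ^ (n + 1)]: its leading term becomes
   [a ^ (N * (n + 1))] and the other terms are multiples of [x]. *)
exists (N * n.+1)%N, (- \sum_(i < n.+1) q`_i * a ^+ (N * i) * x ^+ (n - i)).
apply: inj; apply/eqP; rewrite -subr_eq0 -opprB oppr_eq0; apply/eqP.
transitivity (iota x ^+ n.+1 * (map_poly iota q).[iota a ^+ N * (iota x)^-1]); last first.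
  by rewrite (rootP rq) mulr0.
rewrite (@horner_coef_wide _ n.+2); last by rewrite (leq_trans (size_poly _ _)) // qn.
rewrite mulrN rmorphN opprK [in RHS]big_ord_recr /= [RHS]mulrDr addrC; congr (_ + _).
  rewrite mulr_sumr rmorph_sum mulr_sumr; apply: eq_bigr => i _.
  rewrite coef_map /= !rmorphM !rmorphXn exprMn -exprM.
  have ile : (i <= n)%N by rewrite -ltnS.
  have -> : iota x ^+ n.+1 = iota x * iota x ^+ (n - i) * iota x ^+ i.
    by rewrite -mulrA -exprD subnK // exprS.
  rewrite exprVn.
  have xi : iota x ^+ i * (iota x ^+ i)^-1 = 1 by rewrite divff // expf_neq0.
  rewrite -[LHS]mulr1 -xi; ring.
rewrite coef_map /= q1 rmorph1 mul1r rmorphXn exprMn -exprM exprVn.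
by rewrite mulrCA divff ?mulr1 // expf_neq0.
Qed.

(** The polynomial [1 + g X] divides a power of [g] only if it divides a power
    of [g X], hence only if it divides a power of [-1]. *)
Lemma poly_not_divides_powers (A : idomainType) : ~ divides_powers {poly A}.
Proof.
move=> [g g0 hg]; pose x := g * 'X + 1%:P.
have sx : size x = (size g).+1 by rewrite /x size_MXaddC (negPf g0).
have [|N [y e]] := hg x; first by rewrite -size_poly_eq0 sx.
pose u : {poly A} := (- 1) ^+ N.
have xd : exists z, x * z = u.
  have := subrXX (x - 1) (- 1) N; rewrite opprK subrK => e'.
  exists (y * 'X ^+ N - \sum_(i < N) (x - 1) ^+ (N.-1 - i) * (- 1) ^+ i).
  rewrite mulrBr -e' mulrA e -exprMn /x polyC1 addrK.
  by rewrite opprB addrC subrK.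
have [z] := xd => /(congr1 (fun p : {poly A} => size p)).
have -> : size u = 1%N.
  rewrite /u -signr_odd; case: (odd N); rewrite ?expr0 ?expr1 ?size_opp size_poly1 //.
have [->|z0] := eqVneq z 0; first by rewrite mulr0 size_poly0.
rewrite size_mul ?sx //; last by rewrite -size_poly_eq0 sx.
have := z0; rewrite -size_poly_gt0; have := g0; rewrite -size_poly_gt0.
by lia.
Qed.

Definition horner_ext (A : idomainType) (iota : {rmorphism A -> F}) (b : F) :
  {rmorphism {poly A} -> F} := horner_eval b \o map_poly iota.

Lemma horner_ext_inj (A : idomainType) (iota : {rmorphism A -> F}) b :
  ~ algebraic_over iota b -> injective (horner_ext iota b).
Proof.
move=> nb p q e; apply/eqP; rewrite -subr_eq0; apply/negPn/negP => pq.
apply: nb; exists (p - q) => //; rewrite /root.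
by have /eqP := rmorphB (horner_ext iota b) p q; rewrite e subrr.
Qed.

(** Adjoin the generators [b] one at a time. An algebraic one joins [c]; a
    transcendental one [y] replaces [A] by the polynomial ring [A[y]], for
    which the conclusion fails. *)
Lemma zariski (b : seq F) : forall (A : idomainType) (iota : {rmorphism A -> F}) c,
  injective iota -> {in c, forall x, algebraic_over iota x} ->
  ring_generated iota (c ++ b) -> divides_powers A.
Proof.
elim: b => [|y b IHb] A iota c inj hc gen.
  by apply: (algebraic_divides_powers inj hc); rewrite -[c]cats0.
have [hy|ny] := pselect (algebraic_over iota y).
  apply: (IHb A iota (y :: c) inj) => [x|].
    by rewrite inE => /orP[/eqP->|/hc].
  move=> S h1 h2; apply: gen => // x hx; apply: h2; move: hx.
  by rewrite !(inE, mem_cat) orbCA orbA.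
have [] := @poly_not_divides_powers A.
apply: (IHb _ (horner_ext iota y) c (horner_ext_inj ny)).
  move=> x /hc[p p0 rp]; exists (map_poly polyC p); first by rewrite map_polyC_eq0.
  rewrite -map_poly_comp (eq_map_poly (g := iota)) // => a /=.
  by rewrite /horner_eval map_polyC hornerC.
have S'in a : exists p, horner_ext iota y p = iota a.
  by exists a%:P; rewrite /= /horner_eval map_polyC hornerC.
move=> S h1 h2 h3 h4; apply: gen => // [a|x].
  by have [p <-] := S'in a.
rewrite mem_cat inE => /or3P[xc|/eqP->|xb]; try by apply: h2; rewrite mem_cat ?xc ?xb ?orbT.
by have := h1 'X; rewrite /= /horner_eval map_polyX hornerX.
Qed.

End ZariskiLemma.

(** If [t] were transcendental modulo [m], the residue field would be a
    finitely generated ring over the polynomial ring in [t], which [zariski]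
    forbids. *)
Lemma nullstellensatz (K : fieldType) (R : comAlgType K) (gs : seq R) (m : prime_idealr R) :
  (forall S : R -> Prop, (forall k, S k%:A) -> {in gs, forall x, S x} ->
    (forall x y, S x -> S y -> S (x + y)) -> (forall x y, S x -> S y -> S (x * y)) ->
    forall x, S x) ->
  maximal_ideal (m : {pred R}) ->
  forall t : R, exists2 f : {poly K}, f != 0 & horner_alg t f \in (m : {pred R}).
Proof.
move=> gen /exists_residue_field[F [pi [pis pim]]] t.
pose iota : {rmorphism K -> F} := pi \o in_alg R.
have inj : injective iota by apply: fmorph_inj.
have [[f f0 rf]|nt] := pselect (algebraic_over iota (pi t)).
  exists f => //; rewrite -pim.
  have -> : pi (horner_alg t f) = (map_poly iota f).[pi t].
    elim/poly_ind: f {f0 rf} => [|p c IHp]; first by rewrite !rmorph0 horner0.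
    rewrite !rmorphD !rmorphM /= horner_algX horner_algC IHp.
    by rewrite !map_polyC map_polyX hornerMXaddC.
  exact: rf.
have [] := @poly_not_divides_powers K.
apply: (@zariski F (map pi gs) _ (horner_ext iota (pi t)) [::] (horner_ext_inj nt)) => //.
move=> S h1 h2 h3 h4 x; have [a ->] := pis x.
apply: (gen (fun a => S (pi a))).
- move=> k; have := h1 k%:P; rewrite /= /horner_eval map_polyC hornerC; exact.
- by move=> y yg; apply: h2; apply: map_f.
- by move=> y z hy hz; rewrite rmorphD; apply: h3.
- by move=> y z hy hz; rewrite rmorphM; apply: h4.
Qed.

(** * Localization at a maximal ideal *)

Section LocalizationAtMaximal.

Variables (R : comNzRingType) (m : prime_idealr R).

Local Notation Rm := (localization m).
Local Notation loc := (@loc_of R m).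

Definition loc_mk (a t : R) (ht : t \notin (m : {pred R})) : Rm :=
  \pi_Rm%qT (@LocRatio R m (a, t) ht).

Lemma loc_mkP (x : Rm) : exists a t ht, x = @loc_mk a t ht.
Proof. by elim/quotW: x => -[[a t] ht]; exists a, t, ht. Qed.

Lemma locD a b : loc (a + b) = loc a + loc b.
Proof. by rewrite [RHS]loc_pi_add; apply: loc_pi_eq => /=; ring. Qed.

Lemma locM a b : loc (a * b) = loc a * loc b.
Proof. by rewrite [RHS]loc_pi_mul; apply: loc_pi_eq => /=; ring. Qed.

Lemma loc0 : loc 0 = 0. Proof. by []. Qed.

Lemma loc1 : loc 1 = 1. Proof. by []. Qed.

Lemma loc_eqP a b : loc a = loc b ->
  exists2 u, u \notin (m : {pred R}) & u * a = u * b.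
Proof.
move=> /eqP/loc_piP[u um /=]; rewrite !mulr1 => e; exists u => //.
by apply/eqP; rewrite -subr_eq0 -mulrBr e.
Qed.

Lemma loc_mk_loc a t ht : @loc_mk a t ht * loc t = loc a.
Proof. by rewrite [LHS]loc_pi_mul; apply: loc_pi_eq => /=; ring. Qed.

Lemma loc_mkE a t ht : @loc_mk a t ht = loc a * @loc_mk 1 t ht.
Proof. by rewrite [RHS]loc_pi_mul; apply: loc_pi_eq => /=; ring. Qed.

Lemma loc_inv t ht : loc t * @loc_mk 1 t ht = 1.
Proof. by rewrite mulrC loc_mk_loc. Qed.

(** The extension of [m]. *)
Definition loc_max : {pred Rm} :=
  [pred x | `[< exists2 a, a \in (m : {pred R}) & exists v, x = loc a * v >]].

Lemma loc_maxPn x : x \notin loc_max -> exists y, x * y = 1.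
Proof.
move=> /asboolPn; have [a [t [ht ->]]] := loc_mkP x => h.
have am : a \notin (m : {pred R}).
  by apply/negP => am; apply: h; exists a => //; rewrite loc_mkE; exists (loc_mk 1 ht).
by exists (loc t * loc_mk 1 am); rewrite mulrA loc_mk_loc loc_inv.
Qed.

Lemma loc_in_max a : (loc a \in loc_max) = (a \in (m : {pred R})).
Proof.
apply/asboolP/idP => [[b bm [v]]|am]; last by exists a => //; exists 1; rewrite mulr1.
have [c [t [ht ->]]] := loc_mkP v => e.
have : loc (a * t) = loc (b * c) by rewrite !locM e -mulrA loc_mk_loc.
move=> /loc_eqP[u um e'].
have : u * (a * t) \in (m : {pred R}) by rewrite e' mulrCA mulrC idealMr.
by rewrite !prime_idealrM (negPf um) (negPf ht) orbF.
Qed.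

Lemma loc_max_unit x y : x * y = 1 -> x \notin loc_max.
Proof.
move=> e; apply/negP => /asboolP[a am [v ev]].
have : loc 1 \in loc_max.
  by apply/asboolP; exists a => //; exists (v * y); rewrite mulrA -ev e.
by rewrite loc_in_max idealr1.
Qed.

Lemma loc_max_ideal : idealr_closed loc_max.
Proof.
split.
- by rewrite -loc0 loc_in_max idealr0.
- by rewrite -loc1 loc_in_max idealr1.
move=> w x y /asboolP[a am [v ->]] /asboolP[b bm [v' ->]]; apply/asboolP.
have [c [t [ht ev]]] := loc_mkP (w * v); have [d [u [hu ev']]] := loc_mkP v'.
exists (a * c * u + b * d * t).
  by apply: rpredD; rewrite mulrC; apply: idealMr; rewrite mulrC; apply: idealMr.
exists (loc_mk 1 ht * loc_mk 1 hu).
have -> : w * (loc a * v) = loc a * (w * v) by ring.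
rewrite ev ev' loc_mkE (loc_mkE d) locD !locM.
have := loc_inv ht; have := loc_inv hu.
move: (loc_mk 1 ht) (loc_mk 1 hu) => i j hj hi.
rewrite -[LHS]addr0.
have -> : (loc a * loc c * loc u + loc b * loc d * loc t) * (i * j) =
  loc a * (loc c * i) * (loc u * j) + loc b * (loc d * j) * (loc t * i) by ring.
by rewrite hi hj !mulr1 addr0.
Qed.

Lemma loc_max_prime : prime_ideal loc_max.
Proof.
split; first exact: loc_max_ideal.
move=> x y; apply: contraLR; rewrite negb_or => /andP[/loc_maxPn[x' ex] /loc_maxPn[y' ey]].
by apply: (@loc_max_unit _ (x' * y')); rewrite mulrACA ex ey mulr1.
Qed.

Lemma proper_in_loc_max (J : {pred Rm}) : idealr_closed J -> {subset J <= loc_max}.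
Proof.
move=> hJ x xJ; apply/negPn/negP => /loc_maxPn[y e].
have [_ /negP J1 _] := hJ; apply: J1; rewrite -e mulrC; exact: idealM.
Qed.

Lemma loc_max_maximal : maximal_ideal loc_max.
Proof. by split=> [|J hJ _]; [exact: loc_max_ideal|exact: proper_in_loc_max]. Qed.

Lemma loc_max_unique (m' : {pred Rm}) : maximal_ideal m' -> m' =i loc_max.
Proof.
move=> [hm' mm'] x; apply/idP/idP; first exact: proper_in_loc_max.
exact: (mm' _ loc_max_ideal (proper_in_loc_max hm')).
Qed.

Lemma loc_prime_chain e : prime_chain Rm e -> prime_chain R e.
Proof.
move=> [p [pP pS]]; exists (fun i => [pred a | loc a \in p i] : {pred R}); split=> i ie.
  have [[p0 p1 pc] pm] := pP i ie; split; first split=> [||a u v].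
  - by rewrite inE loc0.
  - by rewrite inE loc1.
  - by rewrite !inE locD locM; apply: pc.
  by move=> a b; rewrite !inE locM; apply: pm.
have [sp ns] := pS i ie; split=> [a|h]; first by rewrite !inE; apply: sp.
apply: ns => x; have [a [t [ht ->]]] := loc_mkP x => hx.
have [hp _] := pP i (ltnW ie); have [hp' _] := pP i.+1 ie.
have : a \in [pred a | loc a \in p i.+1].
  by rewrite inE -(loc_mk_loc a ht) mulrC idealM.
by move=> /h; rewrite inE loc_mkE mulrC => /idealM; apply.
Qed.

Lemma loc_noetherian : noetherian_ring R -> noetherian_ring Rm.
Proof.
move=> noeth J hJ; have [J0 J1 JC] := hJ.
have [|s hs] := noeth [pred a | loc a \in J].
  split=> [||a u v]; rewrite !inE ?loc0 ?loc1 //.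
  by rewrite locD locM; apply: JC.
exists (map loc s) => x; split; last first.
  apply: ideal_gen_in => // g /mapP[a sa ->].
  by have : a \in [pred a | loc a \in J]; [apply/hs/ideal_gen_base|rewrite inE].
have [a [t [ht ->]]] := loc_mkP x => xJ.
have : a \in [pred a | loc a \in J] by rewrite inE -(loc_mk_loc a ht) mulrC idealM.
move=> /hs ha; rewrite loc_mkE mulrC; apply: ideal_genM.
move: ha; apply: (ideal_gen_ind (Q := fun b => ideal_gen (fun g => g \in map loc s) (loc b))).
- by rewrite loc0; apply: ideal_gen0.
- by move=> b c hb hc; rewrite locD; apply: ideal_genD.
- by move=> b g gs; rewrite locM; apply/ideal_genM/ideal_gen_base/map_f.
Qed.

Lemma loc_ideal_gen (s : seq R) a : ideal_gen (fun g => g \in map loc s) (loc a) ->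
  exists2 u, u \notin (m : {pred R}) & ideal_gen (fun g => g \in s) (u * a).
Proof.
move=> h.
have [u um [b hb e]] : exists2 u, u \notin (m : {pred R}) &
    exists2 b, ideal_gen (fun g => g \in s) b & loc u * loc a = loc b.
  move: h; move: (loc a) => x.
  apply: (ideal_gen_ind (Q := fun x => exists2 u, u \notin (m : {pred R}) &
    exists2 b, ideal_gen (fun g => g \in s) b & loc u * x = loc b)).
  - by exists 1; rewrite ?idealr1 //; exists 0; [apply: ideal_gen0|rewrite mulr0 loc0].
  - move=> {}x y [u um [b hb eb]] [v vm [c hc ec]].
    exists (u * v); first by rewrite prime_idealrM negb_or um.
    exists (v * b + u * c); first by apply: ideal_genD; apply: ideal_genM.
    by rewrite locD !locM -eb -ec; ring.
  - move=> {}x g /mapP[c cs ->]; have [d [t [ht ->]]] := loc_mkP x.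
    exists t => //; exists (d * c); first exact/ideal_genM/ideal_gen_base.
    by rewrite mulrA [loc t * _]mulrC loc_mk_loc locM.
have [v vm e'] : exists2 v, v \notin (m : {pred R}) & v * (u * a) = v * b.
  by apply: loc_eqP; rewrite locM.
exists (v * u); first by rewrite prime_idealrM negb_or vm.
by rewrite -mulrA e'; apply: ideal_genM.
Qed.

Lemma loc_regular_sequence (s : seq R) :
  (forall i, (i < size s)%N -> forall a, ideal_gen (fun g => g \in take i s) (s`_i * a) ->
     ideal_gen (fun g => g \in take i s) a) ->
  {subset s <= (m : {pred R})} -> regular_sequence (map loc s).
Proof.
move=> reg sm; split; last first.
  move=> /(ideal_gen_in loc_max_ideal) h; have [_ /negP + _] := loc_max_ideal; apply.
  by apply: h => _ /mapP[a /sm am ->]; rewrite loc_in_max.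
move=> i; rewrite size_map => hi x; rewrite -map_take (nth_map 0) //.
have [a [t [ht ->]]] := loc_mkP x => /(ideal_genM (loc t)).
have -> : loc t * (loc s`_i * loc_mk a ht) = loc (s`_i * a).
  by rewrite mulrCA [loc t * _]mulrC loc_mk_loc locM.
move=> /loc_ideal_gen[u um]; rewrite mulrCA => /(reg i hi) h.
have -> : loc_mk a ht = (loc_mk 1 ht * loc_mk 1 um) * loc (u * a).
  rewrite loc_mkE locM -{1}[loc a]mul1r -(loc_inv um).
  by move: (loc_mk 1 ht) (loc_mk 1 um) (loc a) (loc u) => *; ring.
apply: ideal_genM.
move: h; apply: (ideal_gen_ind (Q := fun b => ideal_gen (fun g => g \in map loc (take i s)) (loc b))).
- by rewrite loc0; apply: ideal_gen0.
- by move=> b c hb hc; rewrite locD; apply: ideal_genD.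
- by move=> b g gs; rewrite locM; apply/ideal_genM/ideal_gen_base/map_f.
Qed.

(** A regular sequence of length [d] in the maximal ideal gives a chain of
    primes of length [d]. When no chain of primes in [R] is longer, both the
    dimension and the depth of the localization are [d]. *)
Lemma cohen_macaulay_at (s : seq R) : noetherian_ring R ->
  (forall i, (i < size s)%N -> forall a, ideal_gen (fun g => g \in take i s) (s`_i * a) ->
     ideal_gen (fun g => g \in take i s) a) ->
  {subset s <= (m : {pred R})} ->
  (forall e, prime_chain R e -> (e <= size s)%N) ->
  cohen_macaulay_local Rm.
Proof.
move=> noeth reg sm bound; split; first exact: loc_noetherian.
exists loc_max; split; [exact: loc_max_maximal|exact: loc_max_unique|].
have regm := loc_regular_sequence reg sm.
have sub : {subset map loc s <= loc_max}.
  by move=> _ /mapP[a /sm am ->]; rewrite loc_in_max.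
exists (size s); split; split.
- rewrite -(size_map loc); exact: regular_prime_chain regm loc_max_prime sub.
- by move=> e /loc_prime_chain/bound.
- by exists (map loc s); rewrite size_map.
- move=> e [t [<- tsub treg]]; apply/bound/loc_prime_chain.
  exact: regular_prime_chain treg loc_max_prime tsub.
Qed.

End LocalizationAtMaximal.

(** * Minors indexed by a compatible sublattice *)

Section Plucker.

Variables (K : fieldType) (n : nat) (L : {set Lat n}).
Hypothesis compL : compatible L.

Local Notation P := (subposet L).
Local Notation A := {mpoly K[n + n]}.
Local Notation S := {mpoly K[#|L|]}.
Local Notation RL := (RL K L).
Local Notation phi := (RL_phi K L).

Definition lo (p : P) : nat := fst_index (val p).
Definition hi (p : P) : nat := snd_index (val p).

(** In the order of [Pi n] a smaller element is a larger interval, so the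
    complement of [L] is closed under enlarging intervals. *)
Lemma subposet_interval : interval_poset lo hi.
Proof.
have [_ idl] := compL.
split=> [p|p q|p i j pi ij jp]; first exact: (Lat_pairP (val p)).
  by rewrite -Lat_leE.
have jn : (j < n)%N by apply: leq_ltn_trans jp (ltn_ord _).
have inn : (i < n)%N by apply: ltn_trans ij jn.
pose q : Lat n := @LatPair n (Ordinal inn, Ordinal jn) ij.
suff qL : q \in L by exists (exist _ q qL).
apply/negPn/negP => qL.
have [pq|pq] := eqVneq (val p) q; first by move: qL; rewrite -pq (valP p).
have := idl (q : Pi n) (val p : Pi n).
rewrite inE qL inE => /(_ isT) H; have : (val p : Pi n) \notin L.
  apply: H; rewrite lt_neqAle pq /=.
  by rewrite /Order.le /= /Pi_le /= pi.
by rewrite (valP p).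
Qed.

Let IP := subposet_interval.

Lemma minor_plucker (ad bc ac bd ab cd : P) :
  lo ac = lo ad -> hi ac = hi bc -> lo bd = lo bc -> hi bd = hi ad ->
  lo ab = lo ad -> hi ab = lo bc -> lo cd = hi bc -> hi cd = hi ad ->
  binomial_minor K (val ad) * binomial_minor K (val bc)
  - binomial_minor K (val ac) * binomial_minor K (val bd)
  + binomial_minor K (val ab) * binomial_minor K (val cd) = 0.
Proof.
move=> /val_inj h1 /val_inj h2 /val_inj h3 /val_inj h4 /val_inj h5 /val_inj h6
  /val_inj h7 /val_inj h8.
by rewrite /binomial_minor h1 h2 h3 h4 h5 h6 h7 h8; ring.
Qed.

Lemma valRLD (a b : RL) : val (a + b) = val a + val b :> A.
Proof. by []. Qed.
Lemma valRLM (a b : RL) : val (a * b) = val a * val b :> A.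
Proof. by []. Qed.
Lemma valRLZ c (a : RL) : val (c *: a) = c *: val a :> A.
Proof. by []. Qed.

Lemma valRL_sum I (r : seq I) (p : pred I) (F : I -> RL) :
  val (\sum_(i <- r | p i) F i) = \sum_(i <- r | p i) val (F i) :> A.
Proof. by apply: (big_morph val valRLD). Qed.

Lemma valRL_prod I (r : seq I) (p : pred I) (F : I -> RL) :
  val (\prod_(i <- r | p i) F i) = \prod_(i <- r | p i) val (F i) :> A.
Proof. by apply: (big_morph val valRLM). Qed.

Lemma phi_plucker : plucker_mod lo hi phi [pred x | x == 0].
Proof.
move=> ad bc ac bd ab cd _ h1 h2 h3 h4 h5 h6 h7 h8; rewrite inE.
apply/eqP/val_inj => /=; exact: minor_plucker.
Qed.

(** The exponent of [x_i y_j]; since [i < j], it exceeds the exponent of [x_j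
    y_i]. *)
Definition lead_exp (p : P) : 'X_{1..n + n} :=
  (U_(lshift n (fst_index (val p))) + U_(rshift n (snd_index (val p))))%MM.

Lemma mlead_minor p : mlead (binomial_minor K (val p)) = lead_exp p.
Proof.
rewrite /binomial_minor /xvar /yvar -!mpolyXD.
set m1 := (_ + _)%MM; set m2 := (_ + _)%MM.
suff lt : (m2 < m1)%O by rewrite mleadDl ?mleadN !mleadXm.
apply/ltmcP; first by rewrite !mdegD !mdeg1.
have ij := ip_lt IP p.
exists (lshift n (fst_index (val p))) => [j jl|].
  have jE (k : 'I_(n + n)) : (lo p <= k)%N -> (k == j) = false.
    by move=> h; apply/negbTE/eqP => e; move: jl; rewrite -e ltnNge h.
  rewrite !mnmDE !mnm1E !jE //= /lo.
  - by apply: leq_trans (ltnW ij) (leq_addl _ _).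
  - exact: leq_addl.
  - exact: ltnW.
rewrite !mnmDE !mnm1E eqxx !eq_rlshift eq_lshift.
by case: eqP => // e; move: ij; rewrite /lo /hi e !ltnn.
Qed.

Lemma minor_neq0 (p : P) : binomial_minor K (val p) != 0.
Proof.
apply/eqP => e; have := mlead_minor p; rewrite e mlead0 => /mnmP/(_ (lshift n (fst_index (val p)))).
by rewrite /lead_exp mnmDE mnm1E eqxx mnm0E.
Qed.

Lemma mlead_std (s : seq P) :
  mlead (val (std_monomial phi s) : A) = (\sum_(p <- s) lead_exp p)%MM.
Proof.
rewrite valRL_prod /= mlead_prod; last by move=> p _ _; apply: minor_neq0.
by apply: eq_bigr => p _; apply: mlead_minor.
Qed.

(** The exponents of the [x]'s and of the [y]'s give the two lists of endpoints
    as multisets; in a multichain both lists are sorted. *)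
Lemma lead_exp_inj (s t : seq P) : multichain s -> multichain t ->
  (\sum_(p <- s) lead_exp p = \sum_(p <- t) lead_exp p)%MM -> s = t.
Proof.
move=> hs ht e.
have cnt (f : P -> 'I_n) : (forall i, count (fun p => f p == i) s = count (fun p => f p == i) t) ->
    perm_eq [seq (f p : nat) | p <- s] [seq (f p : nat) | p <- t].
  move=> h; rewrite (map_comp val f s) (map_comp val f t); apply: perm_map.
  apply/allP => i _ /=; rewrite !count_map; apply/eqP; exact: h.
have sumE (u : seq P) (c : P -> bool) : (\sum_(p <- u) c p)%N = count c u.
  by elim: u => [|p u IHu]; rewrite ?big_nil // big_cons IHu.
have e1 : map lo s = map lo t.
  apply: (sorted_eq leq_trans anti_leq); last 1 first.
  - apply: (cnt (fun p => fst_index (val p))) => i.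
    have := (mnmP _ _).1 e (lshift n i); rewrite !mnm_sumE.
    rewrite -!sumE => H; move: H; congr (_ = _); apply: eq_bigr => p _;
      by rewrite mnmDE !mnm1E eq_lshift eq_rlshift addn0.
  - by rewrite sorted_map; apply: sub_sorted hs => x y; rewrite (ip_le IP) => /andP[].
  - by rewrite sorted_map; apply: sub_sorted ht => x y; rewrite (ip_le IP) => /andP[].
have e2 : map hi s = map hi t.
  apply: (sorted_eq leq_trans anti_leq); last 1 first.
  - apply: (cnt (fun p => snd_index (val p))) => i.
    have := (mnmP _ _).1 e (rshift n i); rewrite !mnm_sumE.
    rewrite -!sumE => H; move: H; congr (_ = _); apply: eq_bigr => p _;
      by rewrite mnmDE !mnm1E eq_rshift eq_lrshift.
  - by rewrite sorted_map; apply: sub_sorted hs => x y; rewrite (ip_le IP) => /andP[].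
  - by rewrite sorted_map; apply: sub_sorted ht => x y; rewrite (ip_le IP) => /andP[].
elim: s t {hs ht e cnt} e1 e2 => [|x s IHs] [|y t] //= [a1 b1] [a2 b2].
by rewrite (ip_inj IP a1 a2) (IHs t).
Qed.

Lemma std_free : free_on (std_monomial phi) (fun s => multichain s).
Proof.
pose ml s := mlead (val (std_monomial phi s) : A).
have std0 s : (val (std_monomial phi s) : A) != 0.
  by rewrite valRL_prod prodf_seq_neq0; apply/allP => p _; apply: minor_neq0.
apply: (@free_triangular _ _ _ _ _ (fun s t => (ml s < ml t)%O)
   (fun s x => (val x : A)@_(ml s))).
- by move=> s; apply: ltxx.
- by move=> t s u; apply: lt_trans.
- by move=> s a x y; rewrite valRLD valRLZ mcoeffD mcoeffZ.
- by move=> s _; rewrite mleadc_eq0.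
move=> s t hs ht; rewrite -mcoeff_msupp => /msupp_le_mlead; rewrite -/(ml t).
rewrite le_eqVlt => /orP[/eqP e|]; last by right.
by left; apply: lead_exp_inj => //; rewrite -!mlead_std -/(ml _) -e.
Qed.

Definition gen_of (i : 'I_#|L|) : P := exist _ (enum_val i) (enum_valP i).
Definition index_of (p : P) : 'I_#|L| := enum_rank_in (valP p) (val p).

Lemma index_ofK p : gen_of (index_of p) = p.
Proof. by apply: val_inj; rewrite /= enum_rankK_in ?(valP p). Qed.

Lemma gen_ofK i : index_of (gen_of i) = i.
Proof. by apply: enum_val_inj; rewrite enum_rankK_in ?enum_valP. Qed.

Definition pvar (p : P) : S := 'X_(index_of p).

Lemma plucker_map_var (p : P) : plucker_map L (pvar p) = binomial_minor K (val p).
Proof.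
rewrite /plucker_map comp_mpolyXU -tnth_nth tnth_mktuple.
by rewrite -[in RHS](index_ofK p).
Qed.

Lemma pvar_span (f : S) : spans (std_monomial pvar) predT f.
Proof.
have sM (x y : S) : spans (std_monomial pvar) predT x -> spans (std_monomial pvar) predT y ->
    spans (std_monomial pvar) predT (x * y).
  move=> [l _ ->] [k _ ->]; rewrite mulr_suml; apply: spans_sum => ci _.
  rewrite mulr_sumr; apply: spans_sum => cj _; rewrite -scalerAl -scalerAr.
  by do 2!apply: spansZ; rewrite -std_cat; apply: spans_base.
have s1 : spans (std_monomial pvar) predT 1.
  by have := @spans_base _ _ _ (std_monomial pvar) predT [::] isT; rewrite /std_monomial big_nil.
rewrite [f]mpolyE; apply: spans_sum => m _; apply: spansZ.
rewrite mpolyXE_id; apply: (big_ind (spans (std_monomial pvar) predT)) => // i _.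
elim: (m i) => [|k IHk]; rewrite ?expr0 // exprS; apply: sM => //.
have := @spans_base _ _ _ (std_monomial pvar) predT [:: gen_of i] isT.
by rewrite /std_monomial big_seq1 /pvar gen_ofK.
Qed.

Definition quadrics : {pred S} := [pred f | (f \in IL K L) && (f \is 2.-homog)].

Lemma plucker_mapB f g : plucker_map L (f - g) = plucker_map L f - plucker_map L g :> A.
Proof. exact: rmorphB. Qed.
Lemma plucker_mapD f g : plucker_map L (f + g) = plucker_map L f + plucker_map L g :> A.
Proof. exact: rmorphD. Qed.
Lemma plucker_mapM f g : plucker_map L (f * g) = plucker_map L f * plucker_map L g :> A.
Proof. exact: rmorphM. Qed.

Definition quadric_ideal : {pred S} := [pred f | `[< ideal_gen (fun g => g \in quadrics) f >]].

Lemma pvar_plucker : plucker_mod lo hi pvar quadric_ideal.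
Proof.
move=> ad bc ac bd ab cd _ h1 h2 h3 h4 h5 h6 h7 h8; apply/asboolP/ideal_gen_base.
apply/andP; split.
  rewrite inE plucker_mapD plucker_mapB !plucker_mapM !plucker_map_var.
  exact/eqP/minor_plucker.
have h p q : pvar p * pvar q \is 2.-homog.
  by rewrite -mpolyXD dhomogX /= mdegD !mdeg1.
by rewrite rpredD ?rpredB ?h.
Qed.

End Plucker.

(** * Presentation and standard basis of the algebra *)

Section Algebra.

Variables (K : fieldType) (n : nat) (L : {set Lat n}).
Hypothesis compL : compatible L.

Local Notation P := (subposet L).
Local Notation A := {mpoly K[n + n]}.
Local Notation S := {mpoly K[#|L|]}.
Local Notation RL := (RL K L).
Local Notation phi := (RL_phi K L).
Local Notation lo := (@lo n L).
Local Notation hi := (@hi n L).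

Local Notation QI := (@quadric_ideal K n L).

Let IP := subposet_interval compL.

Definition plucker_eval : {rmorphism S -> RL} :=
  mmap (in_alg RL) (fun i => phi (gen_of i)).

Lemma valRLX (a : RL) k : val (a ^+ k) = val a ^+ k :> A.
Proof. by elim: k => // k IHk; rewrite !exprS -IHk. Qed.

Lemma val_plucker_eval f : val (plucker_eval f) = plucker_map L f :> A.
Proof.
rewrite /plucker_map /comp_mpoly /= /mmap valRL_sum; apply: eq_bigr => m _.
rewrite valRLM; congr (_ * _); first by rewrite -alg_mpolyC.
rewrite /mmap1 valRL_prod; apply: eq_bigr => i _.
by rewrite valRLX tnth_mktuple.
Qed.

Lemma plucker_eval_std s : plucker_eval (std_monomial (@pvar K n L) s) = std_monomial phi s.
Proof.
rewrite /std_monomial rmorph_prod; apply: eq_bigr => p _; apply: val_inj.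
by rewrite val_plucker_eval plucker_map_var.
Qed.

Lemma plucker_eval_comb ms c :
  plucker_eval (\sum_(s <- ms) c s *: std_monomial (@pvar K n L) s) = std_comb phi ms c.
Proof.
rewrite rmorph_sum; apply: eq_bigr => s _.
by rewrite -plucker_eval_std -mul_mpolyC rmorphM /= mmapC mulr_algl.
Qed.

Lemma plucker_eval_surj (a : RL) : exists f, a = plucker_eval f.
Proof.
have /asboolP : subalg_val a \in gen_subalg (@is_generator K n L) by apply: (valP a).
move=> /(_ [pred b | `[< exists f, b = plucker_map L f >]]) h.
have /asboolP[f ef] : subalg_val a \in [pred b | `[< exists f : S, b = plucker_map L f >]].
  apply: h.
    split.
    - by apply/asboolP; exists 1; rewrite /plucker_map rmorph1.
    - move=> c u v /asboolP[f ->] /asboolP[g ->]; apply/asboolP; exists (c *: f + g).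
      by rewrite plucker_mapD /plucker_map comp_mpolyZ.
    - move=> u v /asboolP[f ->] /asboolP[g ->]; apply/asboolP; exists (f * g).
      by rewrite plucker_mapM.
  move=> g [p pL ->]; apply/asboolP; exists (pvar K (exist _ p pL)).
  by rewrite plucker_map_var.
by exists f; apply: val_inj; rewrite val_plucker_eval -ef.
Qed.

Lemma quadric_eval f : f \in QI -> plucker_eval f = 0.
Proof.
move=> /asboolP; apply: (ideal_gen_ind (Q := fun f => plucker_eval f = 0)).
- exact: rmorph0.
- by move=> a b ha hb; rewrite rmorphD ha hb addr0.
- move=> a g /andP[/eqP gI _]; rewrite rmorphM (_ : plucker_eval g = 0) ?mulr0 //.
  by apply: val_inj; rewrite val_plucker_eval gI.
Qed.

(** Straightening inside the polynomial ring, modulo the quadrics of [IL]. *)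
Lemma pvar_normal_form (f : S) : exists (ms : seq (seq P)) (c : seq P -> K),
  [/\ uniq ms, all (fun s => multichain s) ms &
      f - \sum_(s <- ms) c s *: std_monomial (@pvar K n L) s \in QI].
Proof.
have Q0 : 0 \in QI by apply/asboolP/ideal_gen0.
have QD : {in QI &, forall a b, a + b \in QI}.
  by move=> a b /asboolP ha /asboolP hb; apply/asboolP/ideal_genD.
have QM a b : b \in QI -> a * b \in QI.
  by move=> /asboolP hb; apply/asboolP/ideal_genM.
have [g hg eg] : spans_mod (@pvar K n L) (QI) (fun s => multichain s) f.
  have [l _ ->] := pvar_span f.
  apply: (big_ind (spans_mod (@pvar K n L) (QI) (fun s => multichain s))).
  - by exists 0; [exact: spans0|rewrite subrr].
  - by move=> x y; apply: spans_modD.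
  move=> ci _; apply: spans_modZ => //.
  apply: spans_mod_sub (straighten_le IP Q0 QD QM (pvar_plucker K (L := L)) ci.2).
  by move=> s /andP[].
have [ms [c [h1 h2 h3]]] := spans_uniq hg.
by exists ms, c; rewrite -h3.
Qed.

Lemma std_uniq_span (a : RL) : exists (ms : seq (seq P)) (c : seq P -> K),
  [/\ uniq ms, all (fun s => multichain s) ms & a = std_comb phi ms c].
Proof.
have [f ->] := plucker_eval_surj a; have [ms [c [h1 h2 /quadric_eval h3]]] := pvar_normal_form f.
exists ms, c; split=> //; move/eqP: h3; rewrite rmorphB subr_eq0 => /eqP->.
exact: plucker_eval_comb.
Qed.

Lemma std_span (a : RL) : spans (std_monomial phi) (fun s => multichain s) a.
Proof.
have [ms [c [_ /allP h ->]]] := std_uniq_span a; apply: spans_sum => s /h hs.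
by apply/spansZ/spans_base.
Qed.

(** The normal form of a relation, modulo quadrics, is a combination of
    standard monomials that vanishes in the algebra; by independence it is
    zero. *)
Lemma quadratic_generation : quadratically_generated (IL K L).
Proof.
exists (@quadrics K n L); split=> [g /andP[]//|f]; split; last first.
  move=> h; have : f \in QI by apply/asboolP.
  by move=> /quadric_eval e; rewrite inE -val_plucker_eval e.
move=> /eqP fI; have [ms [c [h1 h2 h3]]] := pvar_normal_form f.
have : \sum_(s <- ms) c s *: std_monomial phi s = 0.
  have /eqP := quadric_eval h3; rewrite rmorphB subr_eq0.
  have -> : plucker_eval f = 0 by apply: val_inj; rewrite val_plucker_eval fI.
  by rewrite plucker_eval_comb => /eqP.
move=> /(std_free compL h1 h2) c0; move: h3; rewrite big_seq big1 ?subr0.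
  by move/asboolP.
by move=> s /c0->; rewrite scale0r.
Qed.

Lemma RL_noetherian : noetherian_ring RL.
Proof.
apply: (@noetherian_surj S RL plucker_eval) => //.
  move=> y; exact: plucker_eval_surj.
exact: noetherian_mpoly.
Qed.

Lemma phi_inj : injective phi.
Proof.
move=> p q e; have := mlead_minor K compL p; have := mlead_minor K compL q.
have -> : binomial_minor K (val p) = binomial_minor K (val q).
  by have := congr1 val e.
move=> -> h; have [] : [:: p] = [:: q]; last by [].
by apply: (lead_exp_inj compL); rewrite ?big_seq1.
Qed.

Lemma phi_homog p : subalg_val (phi p) \is 2.-homog.
Proof.
by rewrite rpredB // -mpolyXD dhomogX /= mdegD !mdeg1.
Qed.

Lemma std_homog s : subalg_val (std_monomial phi s) \is ((size s).*2).-homog.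
Proof.
elim: s => [|p s IHs]; rewrite /std_monomial.
  rewrite big_nil; exact: dhomog1.
rewrite big_cons; exact: (dhomogM (phi_homog p) IHs).
Qed.

Lemma RL_graded_by : graded_by (RL_graded K L).
Proof.
split.
- move=> m; split; first by rewrite inE; apply: rpred0.
  by move=> c a b; rewrite !inE => ha hb; apply: rpredD => //; apply: rpredZ.
- by move=> i j a b; rewrite !inE; apply: dhomogM.
- move=> a; have [ms [c [_ _ ->]]] := std_uniq_span a.
  exists (\max_(s <- ms) (size s).*2).+1.
  exists (fun m => \sum_(s <- ms | (size s).*2 == m) c s *: std_monomial phi s); split.
    move=> m; rewrite inE; apply: (big_ind (fun x : RL => subalg_val x \is m.-homog)).
    - exact: rpred0.
    - by move=> x y; apply: rpredD.
    - by move=> s /eqP <-; apply/rpredZ/std_homog.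
  rewrite /std_comb big_seq (exchange_big_dep predT) //= big_seq; apply: eq_bigr => s sm.
  have lt : ((size s).*2 < (\max_(s <- ms) (size s).*2).+1)%N.
    by rewrite ltnS (leq_bigmax_seq (F := fun s => (size s).*2)).
  by rewrite (big_pred1 (Ordinal lt)) // => m /=; rewrite eq_sym.
- move=> N c hc e m mN; apply: val_inj => /=.
  have := congr1 (fun x : RL => pihomog mdeg m (subalg_val x)) e.
  have -> : subalg_val (\sum_(m < N) c m) = \sum_(m < N) subalg_val (c m).
    exact: (valRL_sum).
  rewrite linear_sum /= (bigD1 (Ordinal mN)) //= pihomog_dE; last exact: hc.
  rewrite big1 ?addr0 => [->|i]; first by rewrite pihomog0.
  rewrite -val_eqE /= => im; rewrite (pihomog_ne0 _ (hc i)) // eq_sym.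
Qed.

End Algebra.

(** * The four properties *)

Section Main.

Variables (K : fieldType) (n : nat) (L : {set Lat n}).
Hypothesis compL : compatible L.

Local Notation P := (subposet L).
Local Notation A := {mpoly K[n + n]}.
Local Notation S := {mpoly K[#|L|]}.
Local Notation RL := (RL K L).
Local Notation phi := (RL_phi K L).
Local Notation lo := (@lo n L).
Local Notation hi := (@hi n L).
Local Notation lev := (lev lo hi).

Let IP := subposet_interval compL.

(** For nested [a] and [b] the straightening is the three-term relation itself,
    and the coefficients of an expansion in standard monomials are unique. *)
Lemma straightening_first : asl2 phi.
Proof.
move=> a b; wlog ba : a b / strictly_inside lo hi b a.
  move=> W nc; have := nc; rewrite (ip_comparable IP) negbK => /orP[h|h]; last exact: (W a b).
  move=> ms c h1 h2 h3 e s sm; have [||g [s' [h4 h5 h6]]] := W b a h _ ms c h1 h2 h3 _ s sm.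
  - by rewrite comparable_sym.
  - by rewrite mulrC.
  by exists g, s'.
move=> _ ms c ums hms c0 e s sm.
have /andP[h1 h2] := ba; have hb := ip_lt IP b.
have [||| ac ac1 ac2] := @ip_sub _ _ _ _ IP a (lo a) (hi b); try lia.
have [||| bd bd1 bd2] := @ip_sub _ _ _ _ IP a (lo b) (hi a); try lia.
have [||| ab ab1 ab2] := @ip_sub _ _ _ _ IP a (lo a) (lo b); try lia.
have [||| cd cd1 cd2] := @ip_sub _ _ _ _ IP a (hi b) (hi a); try lia.
have /eqP := phi_plucker K ba ac1 ac2 bd1 bd2 ab1 ab2 cd1 cd2.
pose s1 := [:: ac; bd]; pose s2 := [:: ab; cd].
have m1 : multichain s1.
  by rewrite /s1 /multichain /= (ip_le IP) ac1 ac2 bd1 bd2; lia.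
have m2 : multichain s2.
  by rewrite /s2 /multichain /= (ip_le IP) ab1 ab2 cd1 cd2; lia.
have E1 : phi ac * phi bd = std_monomial phi s1.
  by rewrite /std_monomial !big_cons big_nil mulr1.
have E2 : phi ab * phi cd = std_monomial phi s2.
  by rewrite /std_monomial !big_cons big_nil mulr1.
rewrite E1 E2 e => e0.
(* The coordinate functional of [s]. *)
have [T [Tl Tb]] := linear_extension (W := K^o) (fun t => (t == s)%:R) (std_free compL) (std_span compL).
have T0 : T 0 = 0 by have := Tl (-1) 0 0; rewrite scaler0 addr0 scaleN1r addNr.
have TD x y : T (x + y) = T x + T y by have := Tl 1 x y; rewrite !scale1r.
have Tcomb : T (std_comb phi ms c) = c s.
  rewrite /std_comb.
  have -> : T (\sum_(t <- ms) c t *: std_monomial phi t) = \sum_(t <- ms) c t * (t == s)%:R.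
    move/allP: hms; elim: (ms) => [|t l IHl] hl; first by rewrite !big_nil T0.
    rewrite !big_cons Tl IHl ?Tb //; first by apply: hl; rewrite mem_head.
    by move=> u ul; apply: hl; rewrite inE ul orbT.
  rewrite (bigD1_seq s) //= eqxx mulr1 big1 ?addr0 // => t /negPf->.
  by rewrite mulr0.
have [->|s1s] := eqVneq s s1.
  by exists ac, [:: bd]; split; [by []| |]; rewrite (ip_le IP) ac1 ac2; lia.
have [->|s2s] := eqVneq s s2.
  by exists ab, [:: cd]; split; [by []| |]; rewrite (ip_le IP) ab1 ab2; lia.
have := congr1 T e0.
rewrite -[- std_monomial phi s1]scaleN1r TD [X in T X + _]addrC Tl T0 Tcomb !Tb //.
rewrite ![_ == s]eq_sym (negPf s1s) (negPf s2s) scaler0 add0r addr0 => /eqP.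
by rewrite (negPf (c0 s sm)).
Qed.

Lemma RL_is_ASL : is_ASL phi (RL_graded K L).
Proof.
split.
- exact: RL_noetherian.
- exact: (RL_graded_by K compL).
- exact: (@phi_inj K n L compL).
- by move=> p; exists 2%N => //; apply: phi_homog.
- move=> a; have [ms [c [_ _ ->]]] := std_uniq_span compL a.
  rewrite /std_comb; apply: rpred_sum => s _; apply: rpredZ; apply: rpred_prod => p _.
  by apply: mem_gen_subalg; exists p.
- split=> [a|]; last by move=> ms c h1 h2 h3; apply: (std_free compL h1 h2 h3).
  by have [ms [c [_ h1 h2]]] := std_uniq_span compL a; exists ms, c.
- exact: straightening_first.
Qed.

Lemma RL_domain (a b : RL) : a * b = 0 -> a = 0 \/ b = 0.
Proof.
move=> /(congr1 val) /= /eqP; rewrite mulf_eq0 => /orP[] /eqP h; [left|right];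
  exact: val_inj.
Qed.

Lemma RL_prime_chain e : prime_chain RL e -> (e <= size (levels lo hi))%N.
Proof.
apply: (@prime_chain_bound K RL _ (std_monomial phi) (fun s => multichain s) size _ _ _ (2 ^ #|{: P}|)%N).
- have -> : 1 = std_monomial phi [::] by rewrite /std_monomial big_nil.
  exact: spans_base.
- move=> s t _ _; rewrite -std_cat.
  have [||||y hy e0] := @straighten_le K _ P lo hi IP RL phi [pred x | x == 0] _ _ _ _ (s ++ t).
  + by rewrite inE.
  + by move=> x y; rewrite !inE => /eqP-> /eqP->; rewrite addr0.
  + by move=> x y; rewrite !inE => /eqP->; rewrite mulr0.
  + exact: phi_plucker.
  move: e0; rewrite inE subr_eq0 => /eqP->; apply: spans_sub hy => u.
  by rewrite !inE size_cat => /and3P[-> /eqP-> _] /=.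
- exact: (std_span compL).
move=> M; have [tau tinj] := multichain_code IP M.
exists ({set P} * {ffun 'I_(size (levels lo hi)) -> 'I_M.+1})%type, tau; split=> //.
by rewrite card_prod -[#|{set P}|]cardsT -powersetT card_powerset cardsT card_ffun !card_ord.
Qed.

(** Take nonzero polynomials with [f_j(theta_j)] in the maximal ideal, one for
    each level that occurs in [L]. *)
Lemma RL_cohen_macaulay : cohen_macaulay RL.
Proof.
split; first exact: RL_noetherian.
move=> m mm.
have fex j : exists f : {poly K}, f != 0 /\ at_theta lo hi phi j f \in (m : {pred RL}).
  have [|f f0 fm] := @nullstellensatz K RL (map phi (enum {: P})) m _ mm (theta lo hi phi j).
  - move=> Q h1 h2 h3 h4 x; have [ms [c [_ _ ->]]] := std_uniq_span compL x.
    have Q0 : Q 0 by have := h1 0; rewrite scale0r.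
    have Q1 : Q 1 by have := h1 1; rewrite scale1r.
    apply: (big_ind Q Q0 h3) => s _; rewrite -mulr_algl; apply: (h4 _ _ (h1 _)).
    by rewrite /std_monomial; apply: (big_ind Q Q1 h4) => p _; apply: h2; apply: map_f; rewrite mem_enum.
  by exists f.
have [f hf] := choice fex.
pose lv := levels lo hi; pose F j := at_theta lo hi phi j (f j).
have Fnth i : (i < size lv)%N -> (map F lv)`_i = F (nth 0%N lv i).
  by move=> h; rewrite (nth_map 0%N).
have lvl i : (i < size lv)%N -> exists p, nth 0%N lv i = lev p.
  by move=> h; apply: levelsP; apply: mem_nth.
have rex i : exists rho : RL -> RL, (i < size lv)%N ->
    [/\ forall x y, rho (x + y) = rho x + rho y,
        forall k x, (k < size lv)%N -> i != k ->
          rho (F (nth 0%N lv k) * x) = F (nth 0%N lv k) * rho x,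
        forall x, rho (F (nth 0%N lv i) * x) = 0 &
        forall x, exists y, x - rho x = F (nth 0%N lv i) * y].
  have [hi'|] := boolP (i < size lv)%N; last by exists id.
  have [p ep] := lvl i hi'.
  have [rho [r1 r2 r3 r4]] := remainder_operator IP (phi_plucker K (L := L)) (std_free compL)
    (std_span compL) p (f (lev p)).
  exists rho => _; split.
  - by move=> x y; have := r1 1 x y; rewrite !scale1r.
  - move=> k x hk ik; have [q eq] := lvl k hk; rewrite eq; apply: r2.
    by rewrite -eq -ep nth_uniq ?undup_uniq // eq_sym.
  - by rewrite ep.
  - by rewrite ep.
have [rho hrho] := choice rex.
have sz : size (map F lv) = size lv by rewrite size_map.
apply: (@cohen_macaulay_at _ m (map F lv)).
- exact: RL_noetherian.
- apply: (@regular_of_remainders _ _ rho).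
  + exact: RL_domain.
  + move=> i; rewrite sz => hi'; rewrite Fnth //; have [p ep] := lvl i hi'.
    rewrite /F ep; apply: (at_theta_neq0 IP (phi_plucker K (L := L)) (std_free compL) (std_span compL)).
    by have [] := hf (lev p).
  + by move=> i x y; rewrite sz => /hrho[].
  + move=> i k x; rewrite sz => h1 h2 ik; rewrite Fnth //.
    by have [_ h _ _] := hrho i h1; apply: h.
  + by move=> i x; rewrite sz => h1; rewrite Fnth //; have [] := hrho i h1.
  + by move=> i x; rewrite sz => h1; rewrite Fnth //; have [] := hrho i h1.
- by move=> x /mapP[j _ ->]; have [] := hf j.
- by move=> e; rewrite sz; apply: RL_prime_chain.
Qed.

Lemma lat_incl_eval (f : S) : plucker_map [set: Lat n] (lat_incl L f) = plucker_map L f.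
Proof.
rewrite /lat_incl comp_mpolyE /plucker_map rmorph_sum [RHS]comp_mpolyE.
apply: eq_bigr => m _; rewrite /= comp_mpolyZ; congr (_ *: _).
rewrite rmorph_prod; apply: eq_bigr => i _; rewrite rmorphXn /= !tnth_mktuple.
by rewrite comp_mpolyXU -tnth_nth tnth_mktuple enum_rankK_in ?in_setT.
Qed.

Lemma lat_subringP g : g \in lat_subring K L <-> exists f, g = lat_incl L f.
Proof.
split.
  move=> /asboolP /(_ [pred b | `[< exists f, b = lat_incl L f >]]) h.
  apply/asboolP; apply: h.
    split.
    - by apply/asboolP; exists 1; rewrite /lat_incl rmorph1.
    - move=> c u v /asboolP[f ->] /asboolP[f' ->]; apply/asboolP; exists (c *: f + f').
      by rewrite /lat_incl rmorphD /= comp_mpolyZ.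
    - move=> u v /asboolP[f ->] /asboolP[f' ->]; apply/asboolP; exists (f * f').
      by rewrite /lat_incl rmorphM.
  move=> x [i iL ->]; apply/asboolP; exists 'X_(enum_rank_in iL (enum_val i)).
  rewrite /lat_incl comp_mpolyXU -tnth_nth tnth_mktuple enum_rankK_in //.
  by congr 'X_(_); apply: enum_val_inj; rewrite enum_rankK_in ?in_setT.
move=> [f ->]; rewrite /lat_incl comp_mpolyE.
apply: rpred_sum => m _; apply: rpredZ; apply: rpred_prod => i _; apply: rpredX.
rewrite tnth_mktuple; apply: mem_gen_subalg; eexists; last by [].
by rewrite enum_rankK_in ?in_setT ?enum_valP.
Qed.

Lemma elimination g :
  (exists2 f, f \in IL K L & g = lat_incl L f) <->
  (g \in IL K [set: Lat n] /\ g \in lat_subring K L).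
Proof.
split=> [[f fI ->]|[gI /lat_subringP[f ef]]].
  by split; [rewrite inE lat_incl_eval|apply/lat_subringP; exists f].
by exists f => //; rewrite inE -lat_incl_eval -ef.
Qed.

End Main.

Theorem theorem2p5 (K : fieldType) (n : nat) (n_ge2 : (2 <= n)%N)
    (L : {set Lat n}) (subL : sublattice L) (compL : compatible L) :
  is_ASL (RL_phi K L) (RL_graded K L) /\
  quadratically_generated (IL K L) /\
  cohen_macaulay (RL K L) /\
  (forall g : {mpoly K[#|[set: Lat n]|]},
     (exists2 f, f \in IL K L & g = lat_incl L f) <->
     (g \in IL K [set: Lat n] /\ g \in lat_subring K L)).
Proof.
split; first exact: RL_is_ASL.
split; first exact: quadratic_generation.
split; first exact: RL_cohen_macaulay.
exact: elimination.
Qed.
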